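(* There exists a weakly locally finite division ring $D$ with center $F$ such that $\operatorname{GKdim}_F D=1$ and $D$ is not algebraic over $F$.
   Context: A division ring $D$ is weakly locally finite if for every finite subset $S\subseteq D$, the division subring of $D$ generated by $S$ is finite dimensional over its own center. For an algebra $A$ over a field $k$, $\operatorname{GKdim}_k(A)=\sup_V \limsup_{r\to\infty}\log_r \dim_k V^r$, where $V$ ranges over finite dimensional subspaces of $A$ containing $1$ with $\sum_{r\ge1}V^r=A$, and $V^r$ is the span of all products of $r$ elements of $V$. A division ring is algebraic over its center $F$ if each element is a root of a nonzero polynomial with coefficients in $F$.
   Formalization: GKdim is taken as the supremum over all finite dimensional subspaces V containing 1, without requiring the powers of V to sum to the whole algebra; with that requirement no such V exists for a non-algebraic weakly locally finite D, so the supremum would be over an empty family. *)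

(* Defs.v *)
From HB Require Import structures.
From mathcomp Require Import all_boot all_order all_algebra.
From mathcomp Require Import boolp classical_sets reals constructive_ereal ereal sequences exp.
From mathcomp Require Import Rstruct.

Set Implicit Arguments.
Unset Strict Implicit.
Unset Printing Implicit Defensive.

Import Order.TTheory GRing.Theory Num.Theory.
Local Open Scope classical_set_scope.
Local Open Scope ring_scope.

Section DivisionRings.
Variable D : unitRingType.

(** D is a division ring: every nonzero element is invertible
    (a unitRingType is nontrivial, 1 != 0). *)
Definition is_division_ring : Prop := forall x : D, x != 0 -> x \is a GRing.unit.

Definition center : set D := [set z | forall y : D, z * y = y * z].

Definition lincomb (K A : set D) : set D :=
  [set x | exists s : seq (D * D),
      (forall p, p \in s -> K p.1 /\ A p.2) /\ x = \sum_(p <- s) p.1 * p.2].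

Definition spanF (s : seq D) : set D := lincomb center [set x | x \in s].

Definition powV (V : set D) (r : nat) : set D :=
  lincomb center [set x | exists xs : seq D,
      size xs = r /\ (forall y, y \in xs -> V y) /\ x = \prod_(y <- xs) y].

Definition is_divsubring (B : set D) : Prop :=
  B 1 /\ (forall x y, B x -> B y -> B (x - y)) /\ (forall x y, B x -> B y -> B (x * y))
  /\ (forall x, B x -> x != 0 -> B x^-1).

Definition divsub_gen (S : set D) : set D :=
  [set x | forall B, is_divsubring B -> S `<=` B -> B x].

Definition center_of (E : set D) : set D :=
  [set z | E z /\ forall y, E y -> z * y = y * z].

Definition findim_over_own_center (E : set D) : Prop :=
  exists s : seq D, lincomb (center_of E) [set x | x \in s] = E.

Definition weakly_locally_finite : Prop :=
  forall s : seq D, findim_over_own_center (divsub_gen [set x | x \in s]).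

Definition algebraic_over_center : Prop :=
  forall x : D, exists p : {poly D},
    p != 0 /\ (forall i, center p`_i) /\ p.[x] = 0.

Section GK.
Variable R : realType.
Local Open Scope ereal_scope.

(** dim_F of a subspace W: least size of an F-spanning list (+oo if none). *)
Definition dimF (W : set D) : \bar R :=
  ereal_inf [set ((size s)%:R)%:E | s in [set s : seq D | spanF s = W]].

Definition growth (V : set D) : \bar R :=
  limn_esup (fun r : nat => ((ln (fine (dimF (powV V r))) / ln (r%:R))%R)%:E).

Definition GKdimF : \bar R :=
  ereal_sup [set growth V | V in [set V : set D | (exists s, spanF s = V) /\ V 1%R]].
End GK.

End DivisionRings.

(* Main.v *)
(** Let [L] be a field with an automorphism [sigma] of infinite order such that every
    element of [L] is fixed by a positive power of [sigma] and every positive power has a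
    finite fixed field, for instance an algebraic closure of ['F_p] with its Frobenius
    automorphism.  The division ring is [D = L(t; sigma)], the skew rational functions with
    [t x = sigma(x) t], cut out of the additive endomorphisms of the Laurent series
    [L((t; sigma))], where nonzero skew polynomials are invertible by a geometric series.

    Modulo a nonzero skew polynomial the powers of [t] have finitely many remainders, so
    that every element of [D] has a denominator of the form [t^(2m) - t^m], and the same holds
    for every multiple of [m].  Hence finitely many elements of [D] commute with some [t^m],
    and have a common denominator [t^(2m) - t^m], which commutes with all of them, with
    numerators over the finite field fixed by [sigma^m].

    - The centralizer of [t^m] is finite dimensional over its center, and a division
      subring of a division ring that is finite dimensional over its center has the same
      property, by a density argument.
    - The center of [D] is the field fixed by [sigma], over which [t] is transcendental.
    - If [C] is a common denominator of [V], then [C^r V^r] consists of skew polynomials of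
      degree linear in [r] over a finite field, so that the dimension of [V^r] is at most
      linear in [r]; for [V = <1, t>] it is at least [r + 1]. *)
Require Import Defs.
From HB Require Import structures.
From mathcomp Require Import all_boot all_order all_algebra.
From mathcomp Require Import boolp classical_sets reals constructive_ereal ereal sequences exp.
From mathcomp Require Import Rstruct.
From mathcomp Require Import closed_field functions.

Set Implicit Arguments.
Unset Strict Implicit.
Unset Printing Implicit Defensive.

Import Order.TTheory GRing.Theory Num.Theory.
Local Open Scope classical_set_scope.
Local Open Scope ring_scope.

(** * Division subrings and their linear algebra *)

Section DivisionSubrings.
Variable D : unitRingType.
Implicit Types (A B E K P : set D) (e s : seq D) (x y z : D).

Lemma divsubring1 K : is_divsubring K -> K 1.
Proof. by case. Qed.

Lemma divsubringB K x y : is_divsubring K -> K x -> K y -> K (x - y).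
Proof. by case=> _ [KB _]; exact: KB. Qed.

Lemma divsubringM K x y : is_divsubring K -> K x -> K y -> K (x * y).
Proof. by case=> _ [_ [KM _]]; exact: KM. Qed.

Lemma divsubring0 K : is_divsubring K -> K 0.
Proof. by move=> KK; rewrite -(subrr 1); apply: divsubringB => //; exact: divsubring1. Qed.

Lemma divsubringV K x : is_divsubring K -> K x -> K x^-1.
Proof.
move=> KK Kx; have [->|x0] := eqVneq x 0; first by rewrite invr0; exact: divsubring0.
by case: KK => _ [_ [_ KV]]; exact: KV.
Qed.

Lemma divsubringN K x : is_divsubring K -> K x -> K (- x).
Proof. by move=> KK Kx; rewrite -sub0r; apply: divsubringB => //; exact: divsubring0. Qed.

Lemma divsubringD K x y : is_divsubring K -> K x -> K y -> K (x + y).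
Proof.
by move=> KK Kx Ky; rewrite -(opprK y); apply: divsubringB => //; exact: divsubringN.
Qed.

Lemma divsubringX K x n : is_divsubring K -> K x -> K (x ^+ n).
Proof.
by move=> KK Kx; elim: n => [|n IH]; rewrite ?exprS; [exact: divsubring1|exact: divsubringM].
Qed.

Lemma divsubringI K K' : is_divsubring K -> is_divsubring K' -> is_divsubring (K `&` K').
Proof.
move=> KK KK'; split; [|split; [|split]].
- by split; exact: divsubring1.
- by move=> x y [Kx K'x] [Ky K'y]; split; exact: divsubringB.
- by move=> x y [Kx K'x] [Ky K'y]; split; exact: divsubringM.
- by move=> x [Kx K'x] _; split; exact: divsubringV.
Qed.

Lemma divsub_gen_divsubring A : is_divsubring (divsub_gen A).
Proof.
split; [|split; [|split]].
- by move=> B BB _; exact: divsubring1.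
- by move=> x y gx gy B BB AB; apply: divsubringB => //; [exact: gx|exact: gy].
- by move=> x y gx gy B BB AB; apply: divsubringM => //; [exact: gx|exact: gy].
- by move=> x gx _ B BB AB; apply: divsubringV => //; exact: gx.
Qed.

Definition centralizer A : set D := [set z | forall y, A y -> z * y = y * z].

Lemma centralizerS A B : A `<=` B -> centralizer B `<=` centralizer A.
Proof. by move=> AB z cz y /AB; exact: cz. Qed.

Hypothesis divD : is_division_ring D.

Lemma centralizer_divsubring A : is_divsubring (centralizer A).
Proof.
split; [|split; [|split]].
- by move=> y _; rewrite mulr1 mul1r.
- by move=> x y cx cy z Az; rewrite mulrBl mulrBr cx// cy.
- by move=> x y cx cy z Az; rewrite -mulrA cy// mulrA cx// mulrA.
- move=> x cx x0 z Az; apply: (mulrI (divD x0)).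
  by rewrite mulVKr ?divD// mulrA cx// mulrK ?divD.
Qed.

Lemma center_divsubring : is_divsubring (@center D).
Proof.
rewrite (_ : @center D = centralizer setT); first exact: centralizer_divsubring.
by apply/seteqP; split=> z cz y; [move=> _|]; exact: cz.
Qed.

Lemma center_of_divsubring E : is_divsubring E -> is_divsubring (center_of E).
Proof. by move=> EE; apply: divsubringI => //; exact: centralizer_divsubring. Qed.

Local Notation span K s := (lincomb K [set` s]).

Definition subspace K P : Prop :=
  [/\ P 0, forall x y, P x -> P y -> P (x + y) & forall k x, K k -> P x -> P (k * x)].

Lemma divsubring_subspace K B : is_divsubring B -> K `<=` B -> subspace K B.
Proof.
move=> BB KB; split=> [|x y|k x /KB Bk]; first exact: divsubring0.
- exact: divsubringD.
- exact: divsubringM.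
Qed.

Lemma subspace_premul P x : subspace (@center D) P -> subspace (@center D) [set y | P (x * y)].
Proof.
move=> [P0 PD PZ]; split=> /= [|y z Py Pz|k y ck Py]; first by rewrite mulr0.
- by rewrite mulrDr; exact: PD.
- by rewrite mulrA -ck -mulrA; exact: PZ.
Qed.

Lemma lincomb_min K A P : subspace K P -> A `<=` P -> lincomb K A `<=` P.
Proof.
move=> [P0 PD PZ] AP x [s [sKA ->]]; rewrite big_seq.
by apply: big_ind => // p /sKA[Kp /AP]; exact: PZ.
Qed.

Lemma lincomb0 K A : lincomb K A 0.
Proof. by exists [::]; split=> //; rewrite big_nil. Qed.

Lemma lincombD K A x y : lincomb K A x -> lincomb K A y -> lincomb K A (x + y).
Proof.
case=> s1 [s1KA ->] [s2 [s2KA ->]]; exists (s1 ++ s2); split; last by rewrite big_cat.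
by move=> p; rewrite mem_cat => /orP[/s1KA|/s2KA].
Qed.

Lemma lincomb_sum K A n (F : 'I_n -> D) :
  (forall i, lincomb K A (F i)) -> lincomb K A (\sum_i F i).
Proof.
by move=> AF; apply: big_ind => //; [exact: lincomb0|move=> *; exact: lincombD].
Qed.

Lemma lincomb_scale K A k x : K k -> A x -> lincomb K A (k * x).
Proof.
move=> Kk Ax; exists [:: (k, x)]; split; last by rewrite big_seq1.
by move=> p; rewrite inE => /eqP ->.
Qed.

Lemma lincombZ K A k x : is_divsubring K -> K k -> lincomb K A x -> lincomb K A (k * x).
Proof.
move=> KK Kk [s [sKA ->]]; exists [seq (k * p.1, p.2) | p <- s]; split.
  by move=> _ /mapP[p /sKA[Kp Ap] ->]; split=> //=; exact: divsubringM.
by rewrite big_map mulr_sumr; apply: eq_bigr => p _ /=; rewrite mulrA.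
Qed.

Lemma lincomb_subspace K A : is_divsubring K -> subspace K (lincomb K A).
Proof.
by move=> KK; split; [exact: lincomb0|move=> *; exact: lincombD|move=> *; exact: lincombZ].
Qed.

Lemma lincomb_mem K A : is_divsubring K -> A `<=` lincomb K A.
Proof.
by move=> KK x Ax; rewrite -[x]mul1r; apply: lincomb_scale => //; exact: divsubring1.
Qed.

Lemma lincombSl K K' A : K `<=` K' -> lincomb K A `<=` lincomb K' A.
Proof. by move=> KK' x [s [sKA ->]]; exists s; split=> // p /sKA[/KK']. Qed.

Lemma lincombSr K A B : A `<=` B -> lincomb K A `<=` lincomb K B.
Proof. by move=> AB x [s [sKA ->]]; exists s; split=> // p /sKA[Kp /AB]. Qed.

Lemma spanF_mull s x y : spanF s y -> spanF [seq x * z | z <- s] (x * y).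
Proof.
move=> [c [c_span ->]]; rewrite mulr_sumr big_seq; apply: big_ind.
- exact: lincomb0.
- by move=> *; exact: lincombD.
- move=> p /c_span[cp sp]; rewrite mulrA -cp -mulrA; apply: lincomb_scale => //.
  exact: map_f.
Qed.

Lemma span_cons K v s x : is_divsubring K ->
  span K (v :: s) x <-> exists2 k, K k & span K s (x - k * v).
Proof.
move=> KK; split=> [|[k Kk xs]].
- move: x; apply: lincomb_min.
    split=> [|x y [k Kk xs] [l Kl ys]|c x Kc [k Kk xs]].
    + by exists 0; [exact: divsubring0|rewrite mul0r subrr; exact: lincomb0].
    + exists (k + l); first exact: divsubringD.
      by rewrite mulrDl opprD addrACA; exact: lincombD.
    + exists (c * k); first exact: divsubringM.
      by rewrite -mulrA -mulrBr; exact: lincombZ.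
  move=> x /=; rewrite inE => /predU1P[->|xs].
    by exists 1; [exact: divsubring1|rewrite mul1r subrr; exact: lincomb0].
  by exists 0; [exact: divsubring0|rewrite mul0r subr0; exact: lincomb_mem].
- rewrite -[x](subrK (k * v)); apply: lincombD; last first.
    by apply: lincomb_scale => //=; exact: mem_head.
  by apply: lincombSr xs => y /= ys; rewrite inE ys orbT.
Qed.

Section LinearIndependence.
Variable K : set D.
Hypothesis KK : is_divsubring K.

Fixpoint independent s : Prop :=
  if s is x :: s' then ~ span K s' x /\ independent s' else True.

Lemma span_replace a x v : span K (v :: a) x -> ~ span K a x -> span K (x :: a) v.
Proof.
move=> /(span_cons _ _ _ KK)[k Kk xa] nxa.
have k0 : k != 0 by apply: contra_not_neq nxa => k0; rewrite k0 mul0r subr0 in xa.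
apply/(span_cons _ _ _ KK); exists k^-1; first exact: divsubringV.
rewrite (_ : v - _ = - k^-1 * (x - k * v)).
  by apply: lincombZ => //; apply: divsubringN => //; exact: divsubringV.
by rewrite mulrBr !mulNr mulKr ?divD// opprK addrC.
Qed.

Lemma span_exchange a s x : span K (a ++ s) x -> ~ span K a x ->
  exists2 s', (size s' < size s)%N & span K (a ++ s) `<=` span K (x :: a ++ s').
Proof.
elim: s a => [|v s IH] a; first by rewrite cats0.
have shift : [set` a ++ v :: s] `<=` [set` v :: a ++ s].
  by move=> y /=; rewrite !(inE, mem_cat) orbCA.
move=> xavs nxa; have [xva|nxva] := pselect (span K (v :: a) x).
- exists s => //; apply: lincomb_min; first exact: lincomb_subspace.
  move=> y /shift /=; rewrite inE => /predU1P[->|ys].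
    apply: lincombSr (span_replace xva nxa) => z /=.
    by rewrite !(inE, mem_cat) orbA => ->.
  by apply: lincomb_mem => //=; rewrite inE ys orbT.
- have [|s' ltss' sub] := IH (v :: a) _ nxva; first exact: lincombSr shift x xavs.
  exists (v :: s') => // y /(lincombSr shift) /sub; apply: lincombSr => z /=.
  by rewrite !(inE, mem_cat) (orbCA (z == v)).
Qed.

Lemma steinitz_exchange e s : independent e -> [set` e] `<=` span K s ->
  exists2 s', (size e + size s' <= size s)%N & span K s `<=` span K (e ++ s').
Proof.
elim: e => [_ _|x e IH [nxe ie] es]; first by exists s.
have [|s1 les1 sub1] := IH ie.
  by move=> y ye; apply: es; rewrite /= inE ye orbT.
have [||s2 lts2 sub2] := @span_exchange e s1 x => //; first exact/sub1/es/mem_head.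
exists s2; last by move=> y /sub1/sub2.
by rewrite addSnnS; apply: leq_trans les1; rewrite leq_add2l.
Qed.

Lemma independent_size e s : independent e -> [set` e] `<=` span K s ->
  (size e <= size s)%N.
Proof. by move=> ie /(steinitz_exchange ie)[s' /(leq_trans (leq_addr _ _))]. Qed.

Lemma subspace_spanned P n : subspace K P ->
  (forall e, [set` e] `<=` P -> independent e -> (size e <= n)%N) ->
  exists e, [/\ [set` e] `<=` P, (size e <= n)%N & span K e = P].
Proof.
move=> subP bounded.
suff extend k e : [set` e] `<=` P -> independent e -> (n < size e + k)%N ->
    exists e, [/\ [set` e] `<=` P, (size e <= n)%N & span K e = P].
  exact: (extend n.+1 [::]).
elim: k e => [|k IH] e eP ie; first by rewrite addn0 ltnNge bounded.
have [Pe|/existsNP[x /not_implyP[Px nx]]] := pselect (P `<=` span K e) => ltn.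
  by exists e; split=> //; [exact: bounded|apply/seteqP; split=> //; exact: lincomb_min].
apply: (IH (x :: e)) => //=; last by rewrite addSnnS.
by move=> y; rewrite /= inE => /predU1P[->|/eP].
Qed.

Lemma subspace_of_span s P : subspace K P -> P `<=` span K s ->
  exists2 e, (size e <= size s)%N & span K e = P.
Proof.
move=> subP Ps; have [|e [_ les Ee]] := @subspace_spanned P (size s) subP; last by exists e.
by move=> e eP ie; apply: independent_size => // x /eP/Ps.
Qed.

End LinearIndependence.

Section MultiplicationOperators.
Variable E : set D.
Hypothesis EE : is_divsubring E.
Let ZE : is_divsubring (center_of E) := center_of_divsubring EE.

Inductive mult_op : (D -> D) -> Prop :=
| mult_op_id : mult_op idfun
| mult_opMl a T : E a -> mult_op T -> mult_op (a \*o T)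
| mult_opMr a T : E a -> mult_op T -> mult_op (a \o* T)
| mult_opB T U : mult_op T -> mult_op U -> mult_op (T \- U).

Definition kills (T : D -> D) e : Prop := forall x, x \in e -> T x = 0.

Lemma mult_op_stable T x : mult_op T -> E x -> E (T x).
Proof.
move=> mT Ex; elim: mT => //= [a U Ea _ EU|a U Ea _ EU|U V _ EU _ EV].
- exact: divsubringM.
- exact: divsubringM.
- exact: divsubringB.
Qed.

Lemma mult_op_zmod_morphism T : mult_op T -> zmod_morphism T.
Proof.
move=> mT x y; elim: mT => //= [a U _ _ ->|a U _ _ ->|U V _ -> _ ->].
- by rewrite mulrBr.
- by rewrite mulrBl.
- by rewrite !opprD !opprK addrACA.
Qed.

Lemma mult_op_centralizer T z x : mult_op T -> centralizer E z -> T (z * x) = z * T x.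
Proof.
move=> mT cz; elim: mT => //= [a U Ea _ ->|a U Ea _ ->|U V _ -> _ ->].
- by rewrite !mulrA cz.
- by rewrite mulrA.
- by rewrite mulrBr.
Qed.

Lemma mult_op_span T e x : mult_op T -> kills T e -> span (centralizer E) e x -> T x = 0.
Proof.
move=> mT Te; move: x; apply: (@lincomb_min _ _ [set x | T x = 0]) => //.
have TB := mult_op_zmod_morphism mT.
have T0 : T 0 = 0 by have := TB 0 0; rewrite !subrr.
split=> //= [x y Tx Ty|k x ck Tx]; last by rewrite mult_op_centralizer// Tx mulr0.
by rewrite -(opprK y) TB -(sub0r y) TB Tx Ty T0 !subr0.
Qed.

Lemma mult_op_proportional e x y : E x -> E y ->
  (exists T, [/\ mult_op T, kills T e & T x != 0]) ->
  (forall T, mult_op T -> kills T e -> T x = 0 -> T y = 0) ->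
  exists2 z, center_of E z & forall T, mult_op T -> kills T e -> T y = z * T x.
Proof.
move=> Ex Ey [T1 [mT1 T1e T1x]] xy.
pose T0 := (T1 x)^-1 \*o T1.
have mT0 : mult_op T0.
  by apply: mult_opMl => //; apply: divsubringV => //; exact: mult_op_stable.
have T0e : kills T0 e by move=> u ue; rewrite /T0 /= (T1e u)// mulr0.
have T0x : T0 x = 1 by rewrite /T0 /= mulVr// divD.
have ET0y : E (T0 y) by exact: mult_op_stable.
have Ty T : mult_op T -> kills T e -> T y = T x * T0 y.
  move=> mT Te; apply/eqP; rewrite -subr_eq0; apply/eqP.
  apply: (xy (T \- T x \*o T0)) => [|u ue|].
  - by apply: mult_opB => //; apply: mult_opMl => //; exact: mult_op_stable.
  - by rewrite /= Te// T0e// mulr0 subrr.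
  - by rewrite /= T0x mulr1 subrr.
have cT0y b : E b -> T0 y * b = b * T0 y.
  move=> Eb; have /= -> := Ty (b \o* T0) (mult_opMr Eb mT0); first by rewrite T0x mul1r.
  by move=> u ue; rewrite /= T0e// mul0r.
exists (T0 y) => // T mT Te.
by rewrite Ty// cT0y//; exact: mult_op_stable.
Qed.

(* The Jacobson density argument for the simple module [E] over its multiplication
   operators, whose endomorphism ring is the center of [E]. *)
Lemma mult_op_separates e y : [set` e] `<=` E -> E y ->
  ~ span (center_of E) e y -> exists T, [/\ mult_op T, kills T e & T y != 0].
Proof.
elim: e y => [|x e IH] y eE Ey ny.
  exists idfun; split=> //; first exact: mult_op_id.
  by apply: contra_not_neq ny => /= ->; exact: lincomb0.
have Ex : E x by apply: eE; exact: mem_head.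
have eE' : [set` e] `<=` E by move=> u ue; apply: eE; rewrite /= inE ue orbT.
apply: contrapT => nT.
have xy T : mult_op T -> kills T e -> T x = 0 -> T y = 0.
  move=> mT Te Tx; apply: contrapT => /eqP Ty; apply: nT; exists T; split=> // u.
  by rewrite inE => /predU1P[->|/Te].
have nye : ~ span (center_of E) e y.
  by move=> ye; apply: ny; apply: lincombSr ye => u /= ue; rewrite inE ue orbT.
have [T [mT Te Ty]] := IH y eE' Ey nye.
have [|z [Ez cz] Tyx] := mult_op_proportional Ex Ey _ xy.
  by exists T; split=> //; apply: contra_neq Ty; exact: xy.
have [||U [mU Ue /eqP[]]] := IH (y - z * x) eE'.
- by apply: divsubringB => //; exact: divsubringM.
- by move=> yzx; apply: ny; apply/(span_cons _ _ _ ZE); exists z.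
- by rewrite (mult_op_zmod_morphism mU) mult_op_centralizer// Tyx// subrr.
Qed.

Lemma independent_centralizer e : [set` e] `<=` E ->
  independent (center_of E) e -> independent (centralizer E) e.
Proof.
elim: e => //= x e IH eE [nx ie].
have eE' : [set` e] `<=` E by move=> u ue; apply: eE; rewrite /= inE ue orbT.
split; last exact: IH.
have [|T [mT Te /eqP Tx] xe] := mult_op_separates eE' _ nx; first exact/eE/mem_head.
exact: Tx (mult_op_span mT Te xe).
Qed.

Lemma findim_over_own_center_centralizer s :
  E `<=` span (centralizer E) s -> findim_over_own_center E.
Proof.
move=> Es; have [||e [_ _ Ee]] := @subspace_spanned (center_of E) E (size s); last by exists e.
- by apply: divsubring_subspace => // z [].
- move=> e eE ie; apply: (independent_size (centralizer_divsubring E)).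
    exact: independent_centralizer.
  by move=> x /eE/Es.
Qed.

End MultiplicationOperators.
End DivisionSubrings.

(** * Gelfand-Kirillov dimension *)

Section GelfandKirillovDimension.
Variables (D : unitRingType) (R : realType).
Implicit Types (V W : set D) (s : seq D) (A d m n r : nat).

Definition finite_dimensional W : Prop := exists s, spanF s = W.

Lemma fine_dimF_bounds m n s W : spanF s = W -> (size s <= n)%N ->
  (forall s', spanF s' = W -> (m <= size s')%N) ->
  m%:R <= fine (dimF R W) <= n%:R.
Proof.
move=> sW sn mW.
have dim_ge : (m%:R%:E <= dimF R W)%E.
  by apply: le_ereal_inf_tmp => _ [s' /mW ms' <-]; rewrite lee_fin ler_nat.
have dim_le : (dimF R W <= n%:R%:E)%E.
  apply: (@le_trans _ _ (size s)%:R%:E); last by rewrite lee_fin ler_nat.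
  by apply: ereal_inf_lbound; exists s.
by move: dim_ge dim_le; case: (dimF R W) => //= x; rewrite !lee_fin => -> ->.
Qed.

Definition log_dim V r : R := ln (fine (dimF R (powV V r))) / ln r%:R.

Lemma log_dim_le V A d r : (1 < r)%N ->
  (exists2 s, (size s <= A * r ^ d)%N & spanF s = powV V r) ->
  log_dim V r <= d%:R + ln A.+1%:R / ln r%:R.
Proof.
move=> r1 [s ss Es]; have r0 := ltnW r1.
have lnr : 0 < ln (r%:R : R) by rewrite ln_gt0// ltr1n.
have ss' : (size s <= A.+1 * r ^ d)%N by rewrite (leq_trans ss)// leq_mul2r leqnSn orbT.
have /andP[_ dim_le] := fine_dimF_bounds Es ss' (fun s' _ => leq0n (size s')).
have Ard : (0 < A.+1 * r ^ d)%N by rewrite muln_gt0 expn_gt0 r0.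
have ln_dim : ln (fine (dimF R (powV V r))) <= ln (A.+1 * r ^ d)%:R.
  have [dim0|dim0] := leP (fine (dimF R (powV V r))) 0.
    by rewrite (ln0 dim0) ln_ge0// ler1n.
  by rewrite ler_ln// posrE ltr0n.
rewrite ler_pdivrMr// mulrDl divfK ?gt_eqF// (le_trans ln_dim)// natrM natrX.
by rewrite lnM ?posrE ?exprn_gt0 ?ltr0n// lnXn ?ltr0n// addrC mulr_natl.
Qed.

Lemma log_dim_ge V d r : (1 < r)%N -> finite_dimensional (powV V r) ->
  (forall s, spanF s = powV V r -> (r ^ d <= size s)%N) -> d%:R <= log_dim V r.
Proof.
move=> r1 [s Es] dimV; have r0 := ltnW r1.
have lnr : 0 < ln (r%:R : R) by rewrite ln_gt0// ltr1n.
have /andP[rd _] := fine_dimF_bounds Es (leqnn _) dimV.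
have rd0 : 0 < (r ^ d)%:R :> R by rewrite ltr0n expn_gt0 r0.
rewrite ler_pdivlMr// mulr_natl -lnXn ?ltr0n// -natrX.
by rewrite ler_ln// posrE (lt_le_trans rd0).
Qed.

Local Open Scope ereal_scope.

Lemma growth_le V A d :
  (forall r, (0 < r)%N -> exists2 s, (size s <= A * r ^ d)%N & spanF s = powV V r) ->
  growth R V <= d%:R%:E.
Proof.
move=> dimV; apply/lee_addgt0Pr => e e0.
pose N := (Num.truncn (expR (ln (A.+1%:R : R) / e))).+2.
apply: ge_ereal_inf.
exists (ereal_sup [set (log_dim V r)%:E | r in [set r | (N <= r)%N]]).
  by exists [set r | (N <= r)%N] => //; exists N.
apply: ge_ereal_sup => _ [r /= Nr <-]; rewrite -EFinD lee_fin.
have r1 : (1 < r)%N by apply: leq_trans Nr.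
have lnr : (0 < ln (r%:R : R))%R by rewrite ln_gt0// ltr1n.
apply: le_trans (log_dim_le r1 (dimV r (ltnW r1))) _; rewrite lerD2l ler_pdivrMr//.
rewrite -ler_pdivrMl// mulrC -ler_expR lnK ?posrE ?ltr0n ?(ltnW r1)//.
by apply: le_trans (ltW (truncnS_gt _)) _; rewrite ler_nat (leq_trans _ Nr).
Qed.

Lemma growth_ge V d : (forall r, (0 < r)%N -> finite_dimensional (powV V r)) ->
  (forall r s, spanF s = powV V r -> (r ^ d <= size s)%N) -> d%:R%:E <= growth R V.
Proof.
move=> finV dimV; apply: le_ereal_inf_tmp => _ [P [N _ NP] <-].
apply: le_ereal_sup_tmp; exists (log_dim V N.+2)%:E.
  by exists N.+2 => //; apply: NP; rewrite /= 2?ltnW.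
by rewrite lee_fin log_dim_ge//; [exact: finV|exact: dimV].
Qed.

Lemma GKdimF_eq V0 d : finite_dimensional V0 -> V0 1%R ->
  (forall V, finite_dimensional V -> exists A, forall r, (0 < r)%N ->
     exists2 s, (size s <= A * r ^ d)%N & spanF s = powV V r) ->
  (forall r s, spanF s = powV V0 r -> (r ^ d <= size s)%N) -> GKdimF D R = d%:R%:E.
Proof.
move=> finV0 V01 dim_le dim_ge; apply/eqP; rewrite eq_le; apply/andP; split.
  apply: ge_ereal_sup => _ [V [finV _] <-].
  by have [A dimV] := dim_le V finV; exact: growth_le dimV.
apply: le_ereal_sup_tmp; exists (growth R V0); first by exists V0.
have [A dimV0] := dim_le V0 finV0; apply: growth_ge => // r r0.
by have [s _ Es] := dimV0 r r0; exists s.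
Qed.

End GelfandKirillovDimension.

(** * Skew polynomials *)

Lemma pigeonhole_nat (T : eqType) (f : nat -> T) (s : seq T) :
  (forall i, f i \in s) -> exists i j, (i < j)%N /\ f i = f j.
Proof.
move=> fs; apply: contrapT => nf.
have uf : uniq (map f (iota 0 (size s).+1)).
  rewrite map_inj_uniq ?iota_uniq// => i j fij; apply/eqP.
  case: ltngtP => // ij; exfalso; apply: nf; first by exists i, j.
  by exists j, i.
have : (size (map f (iota 0 (size s).+1)) <= size s)%N.
  by apply: uniq_leq_size => // _ /mapP[i _ ->].
by rewrite size_map size_iota ltnn.
Qed.

Lemma common_multiple (T : eqType) (P : T -> nat -> Prop) (s : seq T) :
  (forall x, x \in s -> exists2 m, (0 < m)%N & forall m', (m %| m')%N -> P x m') ->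
  exists2 m, (0 < m)%N & forall x, x \in s -> forall m', (m %| m')%N -> P x m'.
Proof.
elim: s => [|x s IH] Ps; first by exists 1%N.
have [|m m0 Pm] := IH; first by move=> y ys; apply: Ps; rewrite inE ys orbT.
have [n n0 Pn] := Ps x (mem_head _ _).
exists (m * n)%N => [|y]; first by rewrite muln_gt0 m0.
rewrite inE => /predU1P[->|ys] m' dvdm'.
- by apply: Pn; exact: dvdn_trans (dvdn_mull _ _) dvdm'.
- by apply: Pm => //; exact: dvdn_trans (dvdn_mulr _ _) dvdm'.
Qed.

Lemma size_polyB_lead_ltn (R : nzRingType) (p q : {poly R}) : p != 0 ->
  size q = size p -> lead_coef q = lead_coef p -> (size (p - q)%R < size p)%N.
Proof.
move=> p0 sq lq; have sp : (0 < size p)%N by rewrite size_poly_gt0.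
rewrite -(prednK sp) ltnS; apply/leq_sizeP => i.
rewrite leq_eqVlt => /predU1P[<-|].
  by move: lq; rewrite coefB /lead_coef sq => ->; rewrite subrr.
by rewrite prednK// => spi; rewrite coefB !nth_default ?subrr// sq.
Qed.

Lemma poly_coef_finite (R : nzRingType) (c : seq R) d :
  exists s : seq {poly R}, forall a : {poly R},
    (forall i, a`_i \in c) -> (size a <= d)%N -> a \in s.
Proof.
elim: d => [|d [s IH]].
  by exists [:: 0] => a _; rewrite leqn0 size_poly_eq0 inE.
exists [seq p * 'X + x%:P | p <- s, x <- c] => a ac sa.
have -> : a = drop_poly 1 a * 'X + (a`_0)%:P.
  apply/polyP => i; rewrite coefD coefMX coefC.
  by case: i => [|i] /=; rewrite ?add0r// coef_drop_poly addr0 addn1.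
apply: allpairs_f => //; apply: IH => [i|].
  by rewrite coef_drop_poly.
by rewrite size_drop_poly leq_subLR.
Qed.

Section IteratedAutomorphism.
Variables (L : fieldType) (sigma : {rmorphism L -> L}).
Implicit Types (x : L) (a b : {poly L}).

Lemma iter_is_zmod_morphism n : zmod_morphism (iter n sigma).
Proof. by elim: n => [|n IH] x y //=; rewrite IH rmorphB. Qed.

Lemma iter_is_monoid_morphism n : monoid_morphism (iter n sigma).
Proof.
elim: n => [|n [IH1 IHM]]; first by split.
by split=> [|x y] /=; rewrite ?IH1 ?IHM ?rmorph1 ?rmorphM.
Qed.

HB.instance Definition _ n := GRing.isZmodMorphism.Build L L (iter n sigma)
  (iter_is_zmod_morphism n).
HB.instance Definition _ n := GRing.isMonoidMorphism.Build L L (iter n sigma)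
  (iter_is_monoid_morphism n).

Definition infinite_order : Prop := forall n, (0 < n)%N -> exists x, iter n sigma x != x.

Lemma infinite_order_separates n m : infinite_order -> n != m ->
  exists x, iter n sigma x != iter m sigma x.
Proof.
move=> inf; wlog ltnm : n m / (n < m)%N => [wlog_lt|_].
  rewrite neq_ltn => /orP[lt|lt]; first by apply: wlog_lt => //; rewrite ltn_eqF.
  by have [|x] := wlog_lt m n lt; [rewrite ltn_eqF|exists x; rewrite eq_sym].
have [|x fx] := inf (m - n)%N; first by rewrite subn_gt0.
by exists x; rewrite -(subnKC (ltnW ltnm)) iterD (inj_eq (fmorph_inj _)) eq_sym.
Qed.

Lemma iter_fixed_dvd n m x : (n %| m)%N -> iter n sigma x = x -> iter m sigma x = x.
Proof. by move=> /dvdnP[q ->] fx; rewrite iterM iter_fix. Qed.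

Definition fixed_poly n a : Prop := map_poly (iter n sigma) a = a.

Lemma fixed_poly_coef n a i : fixed_poly n a -> iter n sigma a`_i = a`_i.
Proof. by move=> fa; rewrite -[in RHS]fa coef_map. Qed.

Lemma fixed_polyP n a : (forall i, iter n sigma a`_i = a`_i) -> fixed_poly n a.
Proof. by move=> fa; apply/polyP => i; rewrite coef_map /= fa. Qed.

Lemma fixed_poly_dvd n m a : (n %| m)%N -> fixed_poly n a -> fixed_poly m a.
Proof.
move=> dvdnm fa; apply: fixed_polyP => i.
by apply: iter_fixed_dvd dvdnm _; exact: fixed_poly_coef.
Qed.

Lemma fixed_poly0 n : fixed_poly n 0.
Proof. exact: rmorph0. Qed.

Lemma fixed_polyD n a b : fixed_poly n a -> fixed_poly n b -> fixed_poly n (a + b).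
Proof. by move=> fa fb; rewrite /fixed_poly rmorphD /= fa fb. Qed.

Lemma fixed_polyXn n i : fixed_poly n 'X^i.
Proof. exact: map_polyXn. Qed.

(* The product of [sum_i a_i t^i] and [sum_j b_j t^j] when [t x = sigma(x) t]. *)
Definition skew_mul a b : {poly L} :=
  \sum_(i < size a) a`_i *: (map_poly (iter i sigma) b * 'X^i).

Lemma size_skew_mul_leq a b : (size (skew_mul a b) <= (size a + size b).-1)%N.
Proof.
apply: leq_trans (size_sum _ _ _) _; apply/bigmax_leqP => i _.
apply: leq_trans (size_scale_leq _ _) (leq_trans (size_polyMleq _ _) _).
rewrite size_map_poly size_polyXn addnS /= addnC.
by rewrite -ltnS prednK ?addn_gt0 ?(leq_ltn_trans _ (ltn_ord i))// ltn_add2r.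
Qed.

Lemma map_iterC n m a : map_poly (iter n sigma) (map_poly (iter m sigma) a) =
  map_poly (iter m sigma) (map_poly (iter n sigma) a).
Proof. by apply/polyP => i; rewrite !coef_map /= -!iterD addnC. Qed.

Lemma fixed_skew_mul n a b :
  fixed_poly n a -> fixed_poly n b -> fixed_poly n (skew_mul a b).
Proof.
move=> fa fb; rewrite /fixed_poly rmorph_sum; apply: eq_bigr => i _.
by rewrite /= map_polyZ rmorphM /= map_polyXn map_iterC fb fixed_poly_coef.
Qed.

Lemma coef_skew_mulC a x i : (skew_mul a x%:P)`_i = a`_i * iter i sigma x.
Proof.
rewrite coef_sum; under eq_bigr do rewrite coefZ map_polyC /= mul_polyC coefZ coefXn.
have [lti|gei] := ltnP i (size a).
- rewrite (bigD1 (Ordinal lti))//= eqxx mulr1 big1 ?addr0// => j /negPf nj.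
  by rewrite [i == j]eq_sym (_ : (_ == _) = false) ?mulr0//; exact: nj.
- rewrite nth_default// mul0r big1// => j _.
  by rewrite gtn_eqF ?mulr0// (leq_trans (ltn_ord j)).
Qed.

End IteratedAutomorphism.

Section SkewEvaluation.
Variables (L : fieldType) (R : nzRingType) (sc : {rmorphism L -> R}) (t : R).
Implicit Types (x : L) (a b : {poly L}).

(* The value at [t] of the skew polynomial with coefficients [a] on the left of [t]. *)
Definition skew_eval a : R := (map_poly sc a).[t].

Lemma skew_eval_coef a : skew_eval a = \sum_(i < size a) sc a`_i * t ^+ i.
Proof.
rewrite /skew_eval horner_coef size_map_poly.
by apply: eq_bigr => i _; rewrite coef_map.
Qed.

Lemma skew_eval_is_zmod_morphism : zmod_morphism skew_eval.
Proof. by move=> a b; rewrite /skew_eval raddfB /= hornerD hornerN. Qed.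

HB.instance Definition _ := GRing.isZmodMorphism.Build {poly L} R skew_eval
  skew_eval_is_zmod_morphism.

Lemma skew_evalZ x a : skew_eval (x *: a) = sc x * skew_eval a.
Proof. by rewrite /skew_eval map_polyZ hornerZ. Qed.

Lemma skew_evalC x : skew_eval x%:P = sc x.
Proof. by rewrite /skew_eval map_polyC hornerC. Qed.

Lemma skew_evalXn n : skew_eval 'X^n = t ^+ n.
Proof. by rewrite /skew_eval map_polyXn hornerXn. Qed.

Lemma skew_evalX : skew_eval 'X = t.
Proof. by rewrite -['X]expr1 skew_evalXn. Qed.

Lemma skew_eval1 : skew_eval 1 = 1.
Proof. by rewrite -(expr0 'X) skew_evalXn. Qed.

Lemma skew_evalMX a : skew_eval (a * 'X) = skew_eval a * t.
Proof. by rewrite /skew_eval rmorphM /= map_polyX hornerMX. Qed.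

Lemma skew_evalMXn a n : skew_eval (a * 'X^n) = skew_eval a * t ^+ n.
Proof.
by elim: n => [|n IH]; rewrite ?mulr1// exprSr mulrA skew_evalMX IH exprSr mulrA.
Qed.

Variable sigma : {rmorphism L -> L}.
Hypothesis skew_comm : forall x, t * sc x = sc (sigma x) * t.

Lemma skew_varX_scal n x : t ^+ n * sc x = sc (iter n sigma x) * t ^+ n.
Proof.
elim: n => [|n IH]; first by rewrite mul1r mulr1.
by rewrite exprS -mulrA IH mulrA skew_comm mulrA.
Qed.

Lemma skew_varX_eval n a :
  t ^+ n * skew_eval a = skew_eval (map_poly (iter n sigma) a) * t ^+ n.
Proof.
rewrite !skew_eval_coef size_map_poly mulr_sumr mulr_suml; apply: eq_bigr => i _.
by rewrite coef_map mulrA skew_varX_scal -!mulrA -!exprD addnC.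
Qed.

Lemma skew_eval_mul a b : skew_eval (skew_mul sigma a b) = skew_eval a * skew_eval b.
Proof.
rewrite raddf_sum [skew_eval a]skew_eval_coef mulr_suml; apply: eq_bigr => i _.
by rewrite /= skew_evalZ skew_evalMXn -mulrA skew_varX_eval.
Qed.

Lemma skew_eval_divr a f : a != 0 -> exists q r,
  [/\ skew_eval f = skew_eval q * skew_eval a + skew_eval r, (size r < size a)%N &
      forall n, fixed_poly sigma n a -> fixed_poly sigma n f -> fixed_poly sigma n r].
Proof.
move=> a0; have [d] := ubnP (size f); elim: d f => // d IH f ltfd.
have [ltfa|leaf] := ltnP (size f) (size a).
  by exists 0, f; split=> //; rewrite raddf0 mul0r add0r.
have f0 : f != 0 by rewrite -size_poly_gt0 (leq_trans _ leaf)// size_poly_gt0.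
set m := (size f - size a)%N; pose lm := iter m sigma (lead_coef a).
have lm0 : lm != 0 by rewrite fmorph_eq0 lead_coef_eq0.
pose c := lead_coef f / lm; pose g := c *: (map_poly (iter m sigma) a * 'X^m).
have c0 : c != 0 by rewrite mulf_neq0 ?invr_eq0 ?lead_coef_eq0.
have ltfg : (size (f - g)%R < size f)%N.
  apply: size_polyB_lead_ltn => //.
    by rewrite size_scale// size_mulXn ?map_poly_eq0// size_map_poly subnK.
  by rewrite lead_coefZ lead_coefM lead_coefXn mulr1 lead_coef_map divfK.
have [q [r [Efg ltra fixr]]] := IH (f - g) (leq_trans ltfg (ltnSE ltfd)).
exists (q + c *: 'X^m), r; split=> // [|n fixa fixf].
  rewrite raddfD /= mulrDl skew_evalZ skew_evalXn -mulrA skew_varX_eval.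
  by rewrite addrAC -Efg raddfB /= skew_evalZ skew_evalMXn subrK.
have fixc : iter n sigma c = c.
  rewrite fmorph_div /= /lm -iterD addnC iterD.
  by rewrite [iter n sigma _]fixed_poly_coef// [iter n sigma _]fixed_poly_coef.
apply: fixr => //; rewrite /fixed_poly rmorphB /= fixf map_polyZ /= fixc.
by rewrite [map_poly _ (_ * _)]rmorphM /= map_polyXn map_iterC fixa.
Qed.

End SkewEvaluation.

Record locallyFiniteAut (L : fieldType) := LocallyFiniteAut {
  locally_finite_aut :> {rmorphism L -> L};
  aut_locally_periodic : forall x, exists2 n, (0 < n)%N & iter n locally_finite_aut x = x;
  aut_fixed_finite : forall n, (0 < n)%N ->
    exists s : seq L, forall x, iter n locally_finite_aut x = x -> x \in s }.

(* An overring of the skew polynomial ring [L[t; sigma]] where the nonzero skew polynomials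
   are invertible. *)
Record skewInverting (L : fieldType) (sigma : {rmorphism L -> L}) := SkewInverting {
  skew_ring :> unitRingType;
  skew_scal : {rmorphism L -> skew_ring};
  skew_var : skew_ring;
  skew_comm : forall x, skew_var * skew_scal x = skew_scal (sigma x) * skew_var;
  skew_unit : forall a, a != 0 -> skew_eval skew_scal skew_var a \is a GRing.unit }.

Section LocallyFiniteAutomorphism.
Variables (L : fieldType) (sigma : locallyFiniteAut L).
Implicit Types a : {poly L}.

Lemma locally_finite_aut_surj y : exists x, sigma x = y.
Proof.
by have [[//|n] _ fy] := aut_locally_periodic sigma y; exists (iter n sigma y).
Qed.

Lemma fixed_poly_exists a : exists2 n, (0 < n)%N & fixed_poly sigma n a.
Proof.
elim/poly_ind: a => [|a x [n n0 fa]]; first by exists 1%N => //; exact: fixed_poly0.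
have [m m0 fx] := aut_locally_periodic sigma x.
exists (n * m)%N; first by rewrite muln_gt0 n0.
apply: fixed_polyP => -[|i]; rewrite coefD coefMX coefC /= ?add0r ?addr0.
  by apply: iter_fixed_dvd fx; exact: dvdn_mull.
by apply: fixed_poly_coef; apply: fixed_poly_dvd fa; exact: dvdn_mulr.
Qed.

Lemma fixed_poly_finite n d : (0 < n)%N ->
  exists s : seq {poly L}, forall a, fixed_poly sigma n a -> (size a <= d)%N -> a \in s.
Proof.
move=> n0; have [c fix_c] := aut_fixed_finite sigma n0.
have [s poly_s] := poly_coef_finite c d.
by exists s => a fa; apply: poly_s => i; apply: fix_c; exact: fixed_poly_coef.
Qed.

End LocallyFiniteAutomorphism.

Section SkewPolynomials.
Variables (L : fieldType) (sigma : {rmorphism L -> L}) (S : skewInverting sigma).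
Implicit Types (x : L) (a b : {poly L}) (T U C : S).

Local Notation sc := (skew_scal S).
Local Notation t := (skew_var S).
Local Notation op := (skew_eval sc t).

Lemma skew_eval_unitE a : (op a \is a GRing.unit) = (a != 0).
Proof. by apply/idP/idP => [|/skew_unit//]; apply: contraTneq => ->; rewrite raddf0 unitr0. Qed.

Lemma skew_eval_eq0 a : op a = 0 -> a = 0.
Proof. by move=> Ea; apply/eqP; rewrite -[_ == _]negbK -skew_eval_unitE Ea unitr0. Qed.

Lemma skew_eval_inj : injective op.
Proof. exact: raddf_inj skew_eval_eq0. Qed.

Lemma skew_var_unit : t \is a GRing.unit.
Proof. by rewrite -(skew_evalX sc t) skew_eval_unitE polyX_eq0. Qed.

Lemma skew_eval_commP n a : GRing.comm (op a) (t ^+ n) <-> fixed_poly sigma n a.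
Proof.
rewrite /GRing.comm (skew_varX_eval (skew_comm S)).
by split=> [/(mulIr (unitrX n skew_var_unit))/skew_eval_inj/esym//|->].
Qed.

Definition skew_den m : S := t ^+ (m + m) - t ^+ m.

Lemma skew_denE m : skew_den m = op ('X^(m + m) - 'X^m).
Proof. by rewrite raddfB /= !skew_evalXn. Qed.

Lemma skew_den_unit m : (0 < m)%N -> skew_den m \is a GRing.unit.
Proof.
move=> m0; rewrite skew_denE skew_eval_unitE.
apply/eqP => /(congr1 (fun p : {poly L} => p`_m)) /eqP.
by rewrite coefB !coefXn coef0 eqxx -{1}[m]addn0 eqn_add2l ltn_eqF// sub0r oppr_eq0 oner_eq0.
Qed.

Lemma skew_den_comm n m T :
  GRing.comm T (t ^+ n) -> (n %| m)%N -> GRing.comm T (skew_den m).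
Proof.
move=> cT /dvdnP[q ->].
by apply: commrB; rewrite ?exprD mulnC exprM; do ?apply: commrM; exact: commrX.
Qed.

Definition left_ideal C : set S := [set U | exists b, U = op b * C].

(* If [t ^+ (i + l) = t ^+ i] modulo a left ideal, then the powers of [t] from [t ^+ i] on
   are [l]-periodic modulo it. *)
Lemma skew_den_left_ideal i l m C : left_ideal C (t ^+ (i + l) - t ^+ i) ->
  (i <= m)%N -> (l %| m)%N -> left_ideal C (skew_den m).
Proof.
move=> [b Eb] leim /dvdnP[q mE]; rewrite /skew_den {2}mE {mE}.
elim: q => [|q [c Ec]]; first by exists 0; rewrite mul0n addn0 subrr raddf0 mul0r.
have leim' : (i <= m + q * l)%N by rewrite (leq_trans leim)// leq_addr.
exists (skew_mul sigma 'X^(m + q * l - i) b + c).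
rewrite raddfD /= (skew_eval_mul (skew_comm S)) mulrDl -Ec.
rewrite -mulrA -Eb skew_evalXn mulrBr -!exprD addnA subnK//.
by rewrite mulSn [(l + _)%N]addnC addnA addrA subrK.
Qed.

End SkewPolynomials.

(** * Skew fractions *)

Section SkewFractions.
Variables (L : fieldType) (sigma : locallyFiniteAut L) (S : skewInverting sigma).
Implicit Types (x : L) (a b : {poly L}) (T U : S).

Local Notation sc := (skew_scal S).
Local Notation t := (skew_var S).
Local Notation op := (skew_eval sc t).
Let opM := skew_eval_mul (skew_comm S).

(* Modulo a nonzero skew polynomial, the powers of [t] have finitely many remainders. *)
Lemma skew_den_in_left_ideal a : a != 0 ->
  exists2 m, (0 < m)%N & left_ideal (op a) (skew_den S m).
Proof.
move=> a0; have [n n0 fa] := fixed_poly_exists sigma a.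
have /choice[r rP] i : exists r, [/\ fixed_poly sigma n r, (size r < size a)%N &
    exists q, t ^+ i = op q * op a + op r].
  have [q [r [E ltra fixr]]] := skew_eval_divr (skew_comm S) 'X^i a0.
  exists r; split=> //; first by apply: fixr => //; exact: fixed_polyXn.
  by exists q; rewrite -E skew_evalXn.
have [s poly_s] := fixed_poly_finite sigma (size a) n0.
have [|i [j [ltij Er]]] := @pigeonhole_nat _ r s.
  by move=> i; have [fr sr _] := rP i; apply: poly_s => //; exact: ltnW.
have [_ _ [qi Ei]] := rP i; have [_ _ [qj Ej]] := rP j.
exists (i.+1 * (j - i))%N; first by rewrite muln_gt0 subn_gt0.
apply: (@skew_den_left_ideal _ _ _ i (j - i)); last exact: dvdn_mull.
- exists (qj - qi); rewrite (subnKC (ltnW ltij)) Ei Ej Er raddfB /= mulrBl.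
  by rewrite opprD addrACA subrr addr0.
- by apply: leq_trans (leqnSn i) (leq_pmulr _ _); rewrite subn_gt0.
Qed.

Definition skew_frac T : Prop := exists a b, a != 0 /\ op a * T = op b.

Lemma skew_frac_comm T : skew_frac T -> exists2 n, (0 < n)%N & GRing.comm T (t ^+ n).
Proof.
move=> [a [b [a0 Eb]]].
have [n n0 fa] := fixed_poly_exists sigma a; have [m m0 fb] := fixed_poly_exists sigma b.
exists (n * m)%N; first by rewrite muln_gt0 n0.
have /(skew_eval_commP S) ca : fixed_poly sigma (n * m) a.
  by apply: fixed_poly_dvd fa; exact: dvdn_mulr.
have /(skew_eval_commP S) cb : fixed_poly sigma (n * m) b.
  by apply: fixed_poly_dvd fb; exact: dvdn_mull.
rewrite /GRing.comm; apply: (mulrI (skew_unit S a0)).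
by rewrite !mulrA Eb cb ca -mulrA Eb.
Qed.

Definition den_exponent m T : Prop :=
  GRing.comm T (t ^+ m) /\ exists a, skew_den S m * T = op a.

Lemma skew_frac_den T : skew_frac T ->
  exists2 m, (0 < m)%N & forall m', (m %| m')%N -> den_exponent m' T.
Proof.
move=> fT; have [n n0 cT] := skew_frac_comm fT; have [a [b [a0 Eb]]] := fT.
have [m m0 [c Ec]] := skew_den_in_left_ideal a0.
exists (m * n)%N => [|m' dvdm']; first by rewrite muln_gt0 m0.
split.
  have /dvdnP[q ->] := dvdn_trans (dvdn_mull m (dvdnn n)) dvdm'.
  by rewrite mulnC exprM; exact: commrX.
have dvdmm' : (m %| m')%N := dvdn_trans (dvdn_mulr n (dvdnn m)) dvdm'.
have [->|m'0] := posnP m'; first by exists 0; rewrite /skew_den subrr mul0r raddf0.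
have [||d Ed] := @skew_den_left_ideal _ _ S m m m' (skew_den S m) _ _ dvdmm'.
- by exists 1; rewrite skew_eval1 mul1r.
- exact: dvdn_leq.
by exists (skew_mul sigma d (skew_mul sigma c b)); rewrite !opM Ed Ec -!mulrA Eb.
Qed.

Lemma skew_frac_common_den (s : seq S) : (forall T, T \in s -> skew_frac T) ->
  exists2 m, (0 < m)%N & forall T, T \in s -> forall m', (m %| m')%N -> den_exponent m' T.
Proof. by move=> fs; apply: common_multiple => T /fs; exact: skew_frac_den. Qed.

Lemma skew_frac_common_den2 T U : skew_frac T -> skew_frac U ->
  exists2 m, (0 < m)%N & den_exponent m T /\ den_exponent m U.
Proof.
move=> fT fU; have [|m m0 mP] := @skew_frac_common_den [:: T; U].
  by move=> V; rewrite !inE => /orP[]/eqP ->.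
by exists m => //; split; apply: mP; rewrite // !inE eqxx ?orbT.
Qed.

Lemma skew_frac_eval a : skew_frac (op a).
Proof. by exists 1, a; rewrite oner_neq0 skew_eval1 mul1r. Qed.

Lemma skew_fracB T U : skew_frac T -> skew_frac U -> skew_frac (T - U).
Proof.
move=> fT fU; have [m m0 [[_ [a Ea]] [_ [b Eb]]]] := skew_frac_common_den2 fT fU.
exists ('X^(m + m) - 'X^m), (a - b).
by rewrite -(skew_eval_unitE S) -skew_denE skew_den_unit// mulrBr Ea Eb raddfB.
Qed.

Lemma skew_fracM T U : skew_frac T -> skew_frac U -> skew_frac (T * U).
Proof.
move=> fT fU; have [m m0 [[cT [a Ea]] [_ [b Eb]]]] := skew_frac_common_den2 fT fU.
have cden := skew_den_comm cT (dvdnn m).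
pose d : {poly L} := 'X^(m + m) - 'X^m.
exists (skew_mul sigma d d), (skew_mul sigma a b).
rewrite -(skew_eval_unitE S) !opM -skew_denE unitrMl skew_den_unit//; split=> //.
by rewrite -Ea -Eb !mulrA; congr (_ * _); rewrite -!mulrA cden.
Qed.

Lemma skew_fracV T : skew_frac T -> skew_frac T^-1.
Proof.
have [uT [a [b [a0 Eb]]]|nuT] := boolP (T \is a GRing.unit); last by rewrite invr_out.
exists b, a; rewrite -Eb mulrK//; split=> //.
by rewrite -(skew_eval_unitE S) -Eb unitrMl// skew_unit.
Qed.

Lemma skew_frac_unit T : skew_frac T -> T != 0 -> T \is a GRing.unit.
Proof.
move=> [a [b [a0 Eb]]] T0; have ua := skew_unit S a0.
rewrite -(unitrMr _ ua) Eb skew_eval_unitE; apply: contra_neq T0 => b0.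
by rewrite -(mulKr ua T) Eb b0 raddf0 mulr0.
Qed.

Definition skew_fracs : {pred S} := [pred T | `[< skew_frac T >]].

Lemma skew_fracs_divring_closed : divring_closed skew_fracs.
Proof.
split.
- by apply/asboolP; rewrite -(skew_eval1 sc t); exact: skew_frac_eval.
- by move=> T U /asboolP fT /asboolP fU; apply/asboolP; exact: skew_fracB.
- by move=> T U /asboolP fT /asboolP fU; apply/asboolP/skew_fracM/skew_fracV.
Qed.

HB.instance Definition _ := GRing.isDivringClosed.Build S skew_fracs
  skew_fracs_divring_closed.

Definition skew_frac_ring := {T : S | T \in skew_fracs}.
HB.instance Definition _ := SubChoice.on skew_frac_ring.
HB.instance Definition _ := [SubChoice_isSubUnitRing of skew_frac_ring by <:].

End SkewFractions.

Record skewFunctionField (L : fieldType) (sigma : locallyFiniteAut L) := SkewFunctionField {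
  skew_function_ring :> skewInverting sigma;
  skew_function_frac : forall T : skew_function_ring, skew_frac T }.

Section SkewFractionRing.
Variables (L : fieldType) (sigma : locallyFiniteAut L) (S : skewInverting sigma).
Implicit Types (x : L) (a : {poly L}).

Local Notation D := (skew_frac_ring S).
Local Notation sc := (skew_scal S).
Local Notation t := (skew_var S).

Definition skew_frac_val : {rmorphism D -> S} := GRing.RMorphism.clone _ _ (val : D -> S) _.

Lemma skew_frac_val_inj : injective skew_frac_val.
Proof. exact: val_inj. Qed.

Lemma skew_fracs_eval a : skew_eval sc t a \in @skew_fracs L sigma S.
Proof. exact/asboolP/skew_frac_eval. Qed.

Definition skew_frac_scal x : D := Sub (skew_eval sc t x%:P) (skew_fracs_eval x%:P).
Definition skew_frac_var : D := Sub (skew_eval sc t 'X) (skew_fracs_eval 'X).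

Lemma val_skew_frac_scal x : skew_frac_val (skew_frac_scal x) = sc x.
Proof. exact: skew_evalC. Qed.

Lemma val_skew_frac_var : skew_frac_val skew_frac_var = t.
Proof. exact: skew_evalX. Qed.

Lemma skew_frac_scal_is_zmod_morphism : zmod_morphism skew_frac_scal.
Proof.
by move=> x y; apply: skew_frac_val_inj; rewrite rmorphB !val_skew_frac_scal rmorphB.
Qed.

Lemma skew_frac_scal_is_monoid_morphism : monoid_morphism skew_frac_scal.
Proof.
split=> [|x y]; apply: skew_frac_val_inj; rewrite ?rmorphM !val_skew_frac_scal.
  by rewrite !rmorph1.
by rewrite rmorphM.
Qed.

HB.instance Definition _ := GRing.isZmodMorphism.Build L D skew_frac_scal
  skew_frac_scal_is_zmod_morphism.
HB.instance Definition _ := GRing.isMonoidMorphism.Build L D skew_frac_scal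
  skew_frac_scal_is_monoid_morphism.

Lemma val_skew_frac_eval a :
  skew_frac_val (skew_eval skew_frac_scal skew_frac_var a) = skew_eval sc t a.
Proof.
rewrite !skew_eval_coef rmorph_sum; apply: eq_bigr => i _.
by rewrite rmorphM rmorphXn val_skew_frac_scal val_skew_frac_var.
Qed.

Lemma skew_frac_ring_division : is_division_ring D.
Proof.
move=> T T0; apply: (@skew_frac_unit _ _ _ (val T)); first exact/asboolP/(valP T).
by rewrite -(rmorph0 skew_frac_val) (inj_eq skew_frac_val_inj).
Qed.

Lemma skew_frac_comm_scal x :
  skew_frac_var * skew_frac_scal x = skew_frac_scal (sigma x) * skew_frac_var.
Proof.
apply: skew_frac_val_inj; rewrite !(rmorphM skew_frac_val) !val_skew_frac_scal.
by rewrite val_skew_frac_var skew_comm.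
Qed.

Lemma skew_frac_eval_unit a : a != 0 ->
  skew_eval skew_frac_scal skew_frac_var a \is a GRing.unit.
Proof.
move=> a0; apply: skew_frac_ring_division; apply: contra_neq a0 => Ea.
by apply: (@skew_eval_eq0 _ _ S); rewrite -val_skew_frac_eval Ea rmorph0.
Qed.

Definition skew_frac_inverting : skewInverting sigma :=
  @SkewInverting L sigma D skew_frac_scal skew_frac_var skew_frac_comm_scal
    skew_frac_eval_unit.

Lemma skew_frac_inverting_frac (T : skew_frac_inverting) : skew_frac T.
Proof.
have /asboolP[a [b [a0 Eb]]] : val (T : D) \in @skew_fracs L sigma S := valP (T : D).
exists a, b; split=> //; apply: skew_frac_val_inj.
by rewrite rmorphM !val_skew_frac_eval -Eb.
Qed.

Definition skew_frac_function_field : skewFunctionField sigma :=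
  SkewFunctionField skew_frac_inverting_frac.

End SkewFractionRing.

(** * Skew function fields *)

Section SkewFunctionFields.
Variables (L : fieldType) (sigma : locallyFiniteAut L) (K : skewFunctionField sigma).
Implicit Types (x : L) (a b : {poly L}) (T U C : K) (s : seq K).

Local Notation sc := (skew_scal K).
Local Notation t := (skew_var K).
Local Notation op := (skew_eval sc t).
Let opM := skew_eval_mul (skew_comm K).
Let fracT := @skew_function_frac L sigma K.

Lemma skew_function_division : is_division_ring K.
Proof. by move=> T; exact: skew_frac_unit. Qed.

Let divK := skew_function_division.
Let cK : is_divsubring (@center K) := center_divsubring divK.

Definition fixed_skew_polys n d : set K :=
  [set T | exists a, [/\ fixed_poly sigma n a, (size a <= d)%N & T = op a]].

Lemma fixed_skew_polysD n d T U :
  fixed_skew_polys n d T -> fixed_skew_polys n d U -> fixed_skew_polys n d (T + U).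
Proof.
move=> [a [fa sa ->]] [b [fb sb ->]]; exists (a + b); split; rewrite ?raddfD//.
  exact: fixed_polyD.
by apply: leq_trans (size_polyD _ _) _; rewrite geq_max sa.
Qed.

Lemma fixed_skew_polysM n d e T U : fixed_skew_polys n d.+1 T -> fixed_skew_polys n e.+1 U ->
  fixed_skew_polys n (d + e).+1 (T * U).
Proof.
move=> [a [fa sa ->]] [b [fb sb ->]]; exists (skew_mul sigma a b); split.
- exact: fixed_skew_mul.
- apply: leq_trans (size_skew_mul_leq _ _ _) _.
  by rewrite -subn1 leq_subLR add1n -addnS -addSn leq_add.
- by rewrite opM.
Qed.

Lemma fixed_skew_polys1 n : fixed_skew_polys n 1 1.
Proof.
by exists 1; split; rewrite ?size_poly1 ?skew_eval1// -(expr0 'X); exact: fixed_polyXn.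
Qed.

Section CommutingWithPower.
Variable n : nat.
Hypothesis n0 : (0 < n)%N.

Local Notation B := (centralizer [set t ^+ n]).

Lemma centralizer_varXP T : B T <-> GRing.comm T (t ^+ n).
Proof. by split=> [|cT y ->]; [exact|]. Qed.

Lemma common_den_comm_varX s : (forall T, T \in s -> GRing.comm T (t ^+ n)) ->
  exists m, [/\ (0 < m)%N, (n %| m)%N & forall T, T \in s ->
    exists2 a, fixed_poly sigma n a & skew_den K m * T = op a].
Proof.
move=> cs; have [m m0 mP] := skew_frac_common_den (s := s) (fun T _ => fracT T).
exists (m * n)%N; split=> [||T Ts]; first by rewrite muln_gt0 m0.
  exact: dvdn_mull.
have [_ [a Ea]] := mP T Ts (m * n)%N (dvdn_mulr _ (dvdnn _)).
exists a => //; apply/(skew_eval_commP K); rewrite -Ea.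
apply: commr_sym; apply: commrM; last exact/commr_sym/cs.
by apply: skew_den_comm (dvdn_mull _ (dvdnn n)); exact: commr_refl.
Qed.

Lemma centralizer_varX_span : exists l : seq K,
  B `<=` lincomb (centralizer B) [set` l].
Proof.
have [c fix_c] := aut_fixed_finite sigma n0.
exists [seq sc x * t ^+ i | x <- c, i <- iota 0 n] => T /centralizer_varXP cT.
have [|m [m0 dvdnm /(_ T (mem_head _ _))[a fa Ea]]] := @common_den_comm_varX [:: T].
  by move=> U; rewrite inE => /eqP ->.
have cBB : is_divsubring (centralizer B) := centralizer_divsubring divK B.
have cden : centralizer B (skew_den K m).
  by move=> U /centralizer_varXP cU; apply/esym; exact: skew_den_comm cU dvdnm.
have ctn : centralizer B (t ^+ n) by move=> U /centralizer_varXP ->.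
rewrite -(mulKr (skew_den_unit K m0) T) Ea skew_eval_coef mulr_sumr.
apply: lincomb_sum => i; set q := (i %/ n * n)%N.
have cq : sc a`_i * t ^+ q = t ^+ q * sc a`_i.
  rewrite (skew_varX_scal (skew_comm K)); congr (sc _ * _).
  by apply/esym; apply: iter_fixed_dvd (fixed_poly_coef i fa); exact: dvdn_mull.
have -> : t ^+ i = t ^+ q * t ^+ (i %% n) by rewrite -exprD -divn_eq.
rewrite (mulrA (sc _)) cq -(mulrA (t ^+ q)) mulrA.
apply: lincomb_scale.
- apply: (divsubringM cBB); first exact: (divsubringV cBB).
  by rewrite /q mulnC exprM; exact: (divsubringX _ cBB).
- apply: allpairs_f; first exact: fix_c (fixed_poly_coef i fa).
  by rewrite mem_iota ltn_mod.
Qed.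

End CommutingWithPower.

Lemma skew_weakly_locally_finite : weakly_locally_finite K.
Proof.
move=> s; set E := divsub_gen _.
have [n n0 cs] := skew_frac_common_den (s := s) (fun T _ => fracT T).
have EB : E `<=` centralizer [set t ^+ n].
  move=> T; apply; first exact: centralizer_divsubring.
  by move=> U /= Us; apply/centralizer_varXP; have [] := cs U Us n (dvdnn n).
have [l Bl] := centralizer_varX_span n0.
apply: (findim_over_own_center_centralizer divK (divsub_gen_divsubring _) (s := l)).
by move=> T /EB/Bl; apply: lincombSl; exact: centralizerS.
Qed.

Section Center.
Hypothesis sigma_inf : infinite_order sigma.

Lemma skew_eval_mul_scal a x : op a * sc x = op (skew_mul sigma a x%:P).
Proof. by rewrite opM skew_evalC. Qed.

Lemma skew_eval_monomial a m :
  (forall x, op a * sc x = sc (iter m sigma x) * op a) -> a = a`_m *: 'X^m.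
Proof.
move=> ax; apply/polyP => i; rewrite coefZ coefXn.
have [->|neqim] := eqVneq i m; first by rewrite mulr1.
have [x fx] := infinite_order_separates sigma_inf neqim.
have /skew_eval_inj/(congr1 (fun b : {poly L} => b`_i)) :
    op (skew_mul sigma a x%:P) = op (iter m sigma x *: a).
  by rewrite -skew_eval_mul_scal skew_evalZ.
rewrite coef_skew_mulC coefZ mulrC => /eqP; rewrite -subr_eq0 -mulrBl mulf_eq0.
by rewrite subr_eq0 (negPf fx) => /eqP ->; rewrite mulr0.
Qed.

(* A denominator [t ^+ (k + k) - t ^+ k] of a central element can be replaced by its
   combination [(t ^+ (k + k) - t ^+ k) * x - sigma^k(x) * (t ^+ (k + k) - t ^+ k)], which
   is a monomial. *)
Lemma skew_center_varX T : center T -> exists m a, t ^+ m * T = op a.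
Proof.
move=> cT; have [k k0 /(_ k (dvdnn k))[_ [a Ea]]] := skew_frac_den (fracT T).
have [|x fx] := @infinite_order_separates _ sigma (k + k) k sigma_inf.
  by rewrite -[X in _ != X]addn0 eqn_add2l -lt0n.
pose d := iter (k + k) sigma x - iter k sigma x.
have d0 : d != 0 by rewrite subr_eq0.
have Ed : sc d * t ^+ (k + k) = skew_den K k * sc x - sc (iter k sigma x) * skew_den K k.
  rewrite /skew_den mulrBl !(skew_varX_scal (skew_comm K)) mulrBr.
  by rewrite opprB addrA subrK rmorphB mulrBl.
have EdT : sc d * (t ^+ (k + k) * T) = op a * sc x - sc (iter k sigma x) * op a.
  by rewrite mulrA Ed mulrBl -Ea -!mulrA (cT (sc x)).
exists (k + k)%N, (d^-1 *: (skew_mul sigma a x%:P - iter k sigma x *: a)).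
rewrite skew_evalZ raddfB /= skew_evalZ -skew_eval_mul_scal -EdT (mulrA (sc d^-1)).
by rewrite -(rmorphM sc) mulVf// rmorph1 mul1r.
Qed.

Lemma skew_center T : center T -> exists2 x, sigma x = x & T = sc x.
Proof.
move=> cT; have [m [a Ea]] := skew_center_varX cT.
have aE : a = a`_m *: 'X^m.
  apply: skew_eval_monomial => x.
  by rewrite -Ea -mulrA (cT (sc x)) !mulrA (skew_varX_scal (skew_comm K)).
have TE : T = sc a`_m.
  apply: (mulIr (unitrX m (skew_var_unit K))).
  by rewrite cT Ea [in LHS]aE skew_evalZ skew_evalXn.
exists a`_m => //; apply: (fmorph_inj sc); apply: (mulIr (skew_var_unit K)).
by rewrite -skew_comm -TE cT.
Qed.

Lemma skew_not_algebraic : ~ algebraic_over_center K.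
Proof.
move=> alg; have [p [p0 [cp pt]]] := alg t.
have /choice[x xP] i : exists x, p`_i = sc x by have [x _] := skew_center (cp i); exists x.
pose a := \poly_(i < size p) x i.
have pE : p = map_poly sc a.
  apply/polyP => i; rewrite coef_map coef_poly.
  by case: ltnP => [_|/(nth_default 0) ->]; [exact: xP|rewrite /= rmorph0].
by case/eqP: p0; rewrite pE (@skew_eval_eq0 _ _ K a) ?rmorph0//; rewrite /skew_eval -pE.
Qed.

Lemma fixed_skew_polys_subspace n d : subspace (@center K) (fixed_skew_polys n d).
Proof.
split=> [|T U|z _ /skew_center[x fx ->] [a [fa sa ->]]].
- by exists 0; split; rewrite ?size_poly0 ?raddf0//; exact: fixed_poly0.
- exact: fixed_skew_polysD.
- exists (x *: a); split; rewrite ?skew_evalZ//.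
    apply: fixed_polyP => i; rewrite coefZ rmorphM /= fixed_poly_coef//.
    by rewrite (iter_fixed_dvd (dvd1n n)).
  exact: leq_trans (size_scale_leq _ _) sa.
Qed.

Lemma fixed_skew_polys_span n : (0 < n)%N -> exists c : seq L, forall d,
  fixed_skew_polys n d `<=` spanF [seq sc x * t ^+ i | x <- c, i <- iota 0 d].
Proof.
move=> n0; have [c fix_c] := aut_fixed_finite sigma n0.
exists c => d _ [a [fa sa ->]]; rewrite skew_eval_coef; apply: lincomb_sum => i.
apply: (lincomb_mem cK); apply: allpairs_f; first exact: fix_c (fixed_poly_coef i fa).
by rewrite mem_iota; exact: leq_trans (ltn_ord i) sa.
Qed.

Lemma spanF_common_den s : exists C n d, [/\ C \is a GRing.unit, (0 < n)%N &
  forall T, spanF s T -> GRing.comm T C /\ fixed_skew_polys n d.+1 (C * T)].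
Proof.
have [n n0 /(_ _ _ n (dvdnn n)) cs] := skew_frac_common_den (s := s) (fun T _ => fracT T).
have [|m [m0 dvdnm mP]] := @common_den_comm_varX n n0 s; first by move=> T /cs[].
have /choice[a aP] T : exists a, T \in s -> fixed_poly sigma n a /\ skew_den K m * T = op a.
  by have [/mP[a fa Ea]|_] := boolP (T \in s); [exists a|exists 0].
pose C := skew_den K m; pose d := \max_(T <- s) size (a T).
exists C, n, d; split=> // [|T sT]; first exact: skew_den_unit.
have Cs U : U \in s -> centralizer [set C] U /\ fixed_skew_polys n d.+1 (C * U).
  move=> Us; have [fa Ea] := aP U Us; have [cU _] := cs U Us; split=> [_ ->|].
    exact: skew_den_comm cU dvdnm.
  by exists (a U); split=> //; apply: leqW; exact: leq_bigmax_seq.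
have cC : subspace (@center K) (centralizer [set C]).
  by apply: divsubring_subspace => [|z cz U _ //]; exact: centralizer_divsubring.
have polyC := subspace_premul C (fixed_skew_polys_subspace n d.+1).
split; last by apply: (lincomb_min polyC) sT => U /Cs[].
by have : centralizer [set C] T by [apply: (lincomb_min cC) sT => U /Cs[]|]; exact.
Qed.

Lemma fixed_skew_polys_prod n d C (xs : seq K) :
  (forall T, T \in xs -> GRing.comm T C /\ fixed_skew_polys n d.+1 (C * T)) ->
  fixed_skew_polys n (size xs * d).+1 (C ^+ size xs * \prod_(T <- xs) T).
Proof.
elim: xs => [|T xs IH] Cxs; first by rewrite big_nil mulr1; exact: fixed_skew_polys1.
have [cT polyT] := Cxs T (mem_head _ _).
have polyxs : fixed_skew_polys n (size xs * d).+1 (C ^+ size xs * \prod_(U <- xs) U).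
  by apply: IH => U Us; apply: Cxs; rewrite inE Us orbT.
have := fixed_skew_polysM polyT polyxs; rewrite big_cons /= exprS mulSn -!mulrA.
by rewrite [T * (_ * _)]mulrA (commrX (size xs) cT) -mulrA.
Qed.

Lemma powV_dim_linear (V : set K) : finite_dimensional V -> exists A, forall r, (0 < r)%N ->
  exists2 s, (size s <= A * r)%N & spanF s = powV V r.
Proof.
move=> [s <-]; have [C [n [d [uC n0 CP]]]] := spanF_common_den s.
have [c polys_c] := fixed_skew_polys_span n0.
exists (size c * d.+1)%N => r r0.
pose l := [seq (C ^+ r)^-1 * y | y <- [seq sc x * t ^+ i | x <- c, i <- iota 0 (r * d).+1]].
have powl : powV (spanF s) r `<=` spanF l.
  move=> T powT; rewrite -(mulKr (unitrX r uC) T); apply/spanF_mull/polys_c.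
  move: T powT; apply: lincomb_min.
    exact/subspace_premul/fixed_skew_polys_subspace.
  by move=> _ [xs [<- [Vxs ->]]]; apply: fixed_skew_polys_prod => T /Vxs/CP.
have [s' les' Es'] := subspace_of_span divK cK (lincomb_subspace _ cK) powl.
exists s' => //; apply: leq_trans les' _; rewrite size_map size_allpairs size_iota.
by rewrite -mulnA leq_mul// mulSn mulnC addnC -addn1 leq_add2l.
Qed.

Lemma varX_independent m : independent (@center K) (rev (mkseq (fun i => t ^+ i) m)).
Proof.
elim: m => // m IH; rewrite mkseqS rev_rcons; split=> // span_m.
have : fixed_skew_polys 1 m (t ^+ m).
  apply: lincomb_min span_m; first exact: fixed_skew_polys_subspace.
  move=> T /=; rewrite mem_rev => /mapP[i]; rewrite mem_iota add0n => ltim ->.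
  by exists 'X^i; rewrite size_polyXn skew_evalXn; split=> //; exact: fixed_polyXn.
case=> a [_ sa]; rewrite -(skew_evalXn sc) => /skew_eval_inj Ea.
by move: sa; rewrite -Ea size_polyXn ltnn.
Qed.

Lemma powV_dim_varX r s : spanF s = powV (spanF [:: 1; t]) r -> (r < size s)%N.
Proof.
move=> Es; have := varX_independent r.+1; move/(independent_size divK cK (s := s)).
rewrite size_rev size_mkseq; apply=> T /=; rewrite mem_rev => /mapP[i].
rewrite mem_iota add0n ltnS => /= leir ->; rewrite -/(spanF s) Es.
apply: (lincomb_mem cK); exists (nseq i t ++ nseq (r - i) 1).
rewrite size_cat !size_nseq subnKC//; split=> //; split=> [y|].
  rewrite mem_cat !mem_nseq => y1t; apply: (lincomb_mem cK) => /=; rewrite !inE.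
  by case/orP: y1t => /andP[_ ->]; rewrite ?orbT.
by rewrite big_cat /= !big_nseq !iter_mulr_1 expr1n mulr1.
Qed.

End Center.
End SkewFunctionFields.

(** * Operators on Laurent series *)

Section AdditiveEndomorphisms.
Variable V : zmodType.

Definition additive_funs : {pred V -> V} := [pred f | `[< zmod_morphism f >]].

Lemma additive_funs_zmod_closed : zmod_closed additive_funs.
Proof.
split; first by apply/asboolP => x y; rewrite /= subrr.
move=> f g /asboolP fB /asboolP gB; apply/asboolP => x y.
by rewrite !fctE fB gB !opprD !opprK addrACA.
Qed.

HB.instance Definition _ := GRing.isZmodClosed.Build (V -> V) additive_funs
  additive_funs_zmod_closed.

Definition endo := {f : V -> V | f \in additive_funs}.
HB.instance Definition _ := SubChoice.on endo.
HB.instance Definition _ := [SubChoice_isSubZmodule of endo by <:].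

Definition endo_fun (f : endo) : V -> V := val f.
Coercion endo_fun : endo >-> Funclass.

Lemma endoP (f g : endo) : f =1 g -> f = g.
Proof. by move=> fg; apply: val_inj; apply/funext. Qed.

Lemma endo_is_zmod_morphism (f : endo) : zmod_morphism f.
Proof. exact/asboolP/(valP f). Qed.

HB.instance Definition _ (f : endo) := GRing.isZmodMorphism.Build V V f
  (@endo_is_zmod_morphism f).

Definition Endo (f : V -> V) (fB : zmod_morphism f) : endo :=
  Sub f (asboolT fB : f \in additive_funs).

Definition endo1 : endo := @Endo id (fun x y => erefl).

Definition endo_mul (f g : endo) : endo :=
  @Endo (f \o g) (fun x y => etrans (congr1 f (raddfB g x y)) (raddfB f _ _)).

Lemma endo_mulA : associative endo_mul. Proof. by move=> f g h; exact: endoP. Qed.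
Lemma endo_mul1l : left_id endo1 endo_mul. Proof. by move=> f; exact: endoP. Qed.
Lemma endo_mul1r : right_id endo1 endo_mul. Proof. by move=> f; exact: endoP. Qed.
Lemma endo_mulDl : left_distributive endo_mul +%R.
Proof. by move=> f g h; exact: endoP. Qed.
Lemma endo_mulDr : right_distributive endo_mul +%R.
Proof. by move=> f g h; apply: endoP => x; exact: (raddfD f). Qed.

HB.instance Definition _ := GRing.Zmodule_isPzRing.Build endo
  endo_mulA endo_mul1l endo_mul1r endo_mulDl endo_mulDr.

Lemma inj_surj_endo_invertible (f : endo) : injective f -> (forall y, exists x, f x = y) ->
  exists g : endo, g * f = 1 /\ f * g = 1.
Proof.
move=> f_inj /choice[g gK].
have gB : zmod_morphism g by move=> x y; apply: f_inj; rewrite (endo_is_zmod_morphism f) !gK.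
exists (Endo gB); split; apply: endoP => x; last exact: gK.
by apply: f_inj; exact: gK.
Qed.

End AdditiveEndomorphisms.

Section ClassicalInverse.
Variable R : nzRingType.
Implicit Types x y : R.

Definition invertible x : Prop := exists y, y * x = 1 /\ x * y = 1.

Definition invertibles : {pred R} := [pred x | `[< invertible x >]].

Definition classical_inv x : R :=
  if pselect (invertible x) is left inv_x then sval (cid inv_x) else x.

Lemma classical_mulVr : {in invertibles, left_inverse 1 classical_inv *%R}.
Proof.
move=> x /asboolP inv_x; rewrite /classical_inv.
by case: pselect => // invertible_x; case: (cid invertible_x) => y [].
Qed.

Lemma classical_divrr : {in invertibles, right_inverse 1 classical_inv *%R}.
Proof.
move=> x /asboolP inv_x; rewrite /classical_inv.
by case: pselect => // invertible_x; case: (cid invertible_x) => y [].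
Qed.

Lemma invertiblesP x y : y * x = 1 /\ x * y = 1 -> x \in invertibles.
Proof. by move=> xy; apply/asboolP; exists y. Qed.

Lemma classical_inv_out : {in [predC invertibles], classical_inv =1 id}.
Proof. by move=> x /asboolP nx; rewrite /classical_inv; case: pselect. Qed.

Definition classicalUnitRing : Type := R.
HB.instance Definition _ := GRing.NzRing.on classicalUnitRing.
HB.instance Definition _ := GRing.NzRing_hasMulInverse.Build classicalUnitRing
  classical_mulVr classical_divrr invertiblesP classical_inv_out.

End ClassicalInverse.

Section LaurentSeries.
Variable L : fieldType.
Implicit Types (x : L) (n N : int).

(* A function [u] stands for the formal series [sum_n u_n t^n]. *)
Definition vanishes_below N (f : int -> L) : Prop := forall n, n < N -> f n = 0.

Definition laurent : {pred int -> L} := [pred f | `[< exists N, vanishes_below N f >]].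

Lemma vanishes_belowB N f g :
  vanishes_below N f -> vanishes_below N g -> vanishes_below N (f - g).
Proof. by move=> f0 g0 n ltnN; rewrite !fctE f0// g0// subr0. Qed.

Lemma vanishes_belowD N f g :
  vanishes_below N f -> vanishes_below N g -> vanishes_below N (f + g).
Proof. by move=> f0 g0 n ltnN; rewrite !fctE f0// g0// addr0. Qed.

Lemma vanishes_belowW N N' f : N' <= N -> vanishes_below N f -> vanishes_below N' f.
Proof. by move=> leN f0 n ltn; apply: f0; exact: lt_le_trans leN. Qed.

Lemma laurent_zmod_closed : zmod_closed laurent.
Proof.
split; first by apply/asboolP; exists 0.
move=> f g /asboolP[N f0] /asboolP[M g0]; apply/asboolP; exists (Num.min N M).
by apply: vanishes_belowB; [apply: vanishes_belowW f0|apply: vanishes_belowW g0];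
  rewrite ge_min lexx ?orbT.
Qed.

HB.instance Definition _ := GRing.isZmodClosed.Build (int -> L) laurent
  laurent_zmod_closed.

Definition laurent_series := {f : int -> L | f \in laurent}.
HB.instance Definition _ := SubChoice.on laurent_series.
HB.instance Definition _ := [SubChoice_isSubZmodule of laurent_series by <:].

Implicit Types f g : laurent_series.

Lemma laurent_vanishes f : exists N, vanishes_below N (val f).
Proof. exact/asboolP/(valP f). Qed.

Lemma lt_add_distS N n : n < N + `|n - N|%N.+1%:Z.
Proof. by rewrite -ltrBlDl (le_lt_trans (ler_norm _))// -abszE ltz_nat. Qed.

Lemma laurent_eq0 f N : (forall k : nat, vanishes_below (N + k%:Z) (val f)) -> f = 0.
Proof. by move=> f0; apply: val_inj; apply/funext => n; exact: f0 (lt_add_distS N n). Qed.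

Local Notation E := (endo laurent_series).
Implicit Types (a : {poly L}) (T : E).

Definition raises_order T : Prop :=
  forall N f, vanishes_below N (val f) -> vanishes_below (N + 1) (val (T f)).

Section GeometricSeries.
Variable T : E.
Hypothesis T_raises : raises_order T.

Lemma raising_vanishes N k f :
  vanishes_below (N + k%:Z) (val f) -> vanishes_below (N + k.+1%:Z) (val (T f)).
Proof. by move=> /T_raises; rewrite -addrA -(PoszD k 1) addn1. Qed.

Lemma sub1_raising_inj : injective ((1 - T : E) : laurent_series -> laurent_series).
Proof.
apply: raddf_inj => f /eqP; rewrite -[X in X == 0]/(f - T f) subr_eq0 => /eqP fT.
have [N f0] := laurent_vanishes f; apply: (@laurent_eq0 f N).
by elim=> [|k IH]; [rewrite addr0|rewrite fT; exact: raising_vanishes].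
Qed.

Section PartialSums.
Variables (g : laurent_series) (N : int).
Hypothesis g0 : vanishes_below N (val g).

Definition geometric_sum k : laurent_series := iter k (fun f => g + T f) 0.

Lemma geometric_sum_vanishes k : vanishes_below N (val (geometric_sum k)).
Proof.
elim: k => [|k IH] //; apply: vanishes_belowD => //.
by apply: vanishes_belowW (T_raises IH); rewrite lerDl.
Qed.

Lemma geometric_sum_cauchy k j : (k <= j)%N ->
  vanishes_below (N + k%:Z) (val (geometric_sum j - geometric_sum k)).
Proof.
elim: k j => [|k IH] [|j] // lekj; rewrite ?addr0 ?subr0 ?subrr//.
  exact: geometric_sum_vanishes.
have -> : geometric_sum j.+1 - geometric_sum k.+1 = T (geometric_sum j - geometric_sum k).
  by rewrite (endo_is_zmod_morphism T) /= opprD addrACA subrr add0r.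
exact/raising_vanishes/IH.
Qed.

Lemma geometric_sum_stable k j n : (k <= j)%N -> n < N + k%:Z ->
  val (geometric_sum j) n = val (geometric_sum k) n.
Proof.
by move=> lekj ltn; apply/eqP; rewrite -subr_eq0; apply/eqP/(geometric_sum_cauchy lekj).
Qed.

Definition geometric_limit n : L := val (geometric_sum `|n - N|%N.+1) n.

Lemma geometric_limitE k n : n < N + k%:Z -> geometric_limit n = val (geometric_sum k) n.
Proof.
move=> ltn; have ltn' := lt_add_distS N n; rewrite /geometric_limit.
rewrite -(geometric_sum_stable (leq_maxl _ k) ltn').
exact: geometric_sum_stable (leq_maxr _ _) ltn.
Qed.

Lemma geometric_limit_laurent : geometric_limit \in laurent.
Proof.
apply/asboolP; exists N => n ltn.
by rewrite (@geometric_limitE 0) ?addr0// geometric_sum_vanishes.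
Qed.

End PartialSums.

Lemma sub1_raising_surj g : exists f, (1 - T : E) f = g.
Proof.
have [N g0] := laurent_vanishes g.
pose f : laurent_series := Sub (geometric_limit g N) (geometric_limit_laurent g0).
exists f; apply: val_inj; apply/funext => n.
pose k := `|n - N|%N.+1; have ltk : n < N + k%:Z := lt_add_distS N n.
have ltk1 : n < N + k.+1%:Z by rewrite (lt_trans ltk)// ltrD2l ltz_nat.
have Tfk : val (T f) n = val (T (geometric_sum g k)) n.
  apply/eqP; rewrite -subr_eq0; apply/eqP.
  rewrite -[LHS]/(val (T f - T _) n) -(endo_is_zmod_morphism T).
  apply: (raising_vanishes (k := k)) ltk1 => m ltm.
  rewrite -[LHS]/(geometric_limit g N m - val (geometric_sum g k) m).
  by rewrite (geometric_limitE g0 ltm) subrr.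
rewrite -[LHS]/(geometric_limit g N n - val (T f) n) Tfk; apply/eqP; rewrite subr_eq.
by rewrite (geometric_limitE g0 ltk1).
Qed.

End GeometricSeries.

Section LaurentOperators.
Variable F : (int -> L) -> int -> L.
Hypothesis FB : zmod_morphism F.
Hypothesis F_vanishes : forall N u, vanishes_below N u -> vanishes_below N (F u).

Lemma laurent_operator_laurent f : F (val f) \in laurent.
Proof. by have [N f0] := laurent_vanishes f; apply/asboolP; exists N; exact: F_vanishes. Qed.

Definition laurent_map f : laurent_series := Sub (F (val f)) (laurent_operator_laurent f).

Lemma laurent_map_is_zmod_morphism : zmod_morphism laurent_map.
Proof. by move=> f g; apply: val_inj; exact: FB. Qed.

Definition laurent_operator : E := Endo laurent_map_is_zmod_morphism.

End LaurentOperators.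

Lemma scale_is_zmod_morphism x : zmod_morphism (fun (u : int -> L) n => x * u n).
Proof. by move=> u v; apply/funext => n; rewrite !fctE mulrBr. Qed.

Lemma scale_vanishes x N u : vanishes_below N u -> vanishes_below N (fun n => x * u n).
Proof. by move=> u0 n /u0 ->; rewrite mulr0. Qed.

Definition laurent_scal x : E :=
  laurent_operator (scale_is_zmod_morphism x) (scale_vanishes x).

Lemma laurent_scal_is_zmod_morphism : zmod_morphism laurent_scal.
Proof.
by move=> x y; apply: endoP => f; apply: val_inj; apply/funext => n; exact: mulrBl.
Qed.

Lemma laurent_scal_is_monoid_morphism : monoid_morphism laurent_scal.
Proof.
split=> [|x y]; apply: endoP => f; apply: val_inj; apply/funext => n; first exact: mul1r.
by rewrite -[LHS]/(x * y * val f n) -mulrA.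
Qed.

HB.instance Definition _ := GRing.isZmodMorphism.Build L E laurent_scal
  laurent_scal_is_zmod_morphism.
HB.instance Definition _ := GRing.isMonoidMorphism.Build L E laurent_scal
  laurent_scal_is_monoid_morphism.

Definition laurent_one : int -> L := fun n => (n == 0)%:R.

Lemma laurent_one_laurent : laurent_one \in laurent.
Proof. by apply/asboolP; exists 0 => n ltn0; rewrite /laurent_one lt_eqF. Qed.

Lemma laurent_endo_nonzero : 1 != 0 :> E.
Proof.
apply/eqP => /(congr1 (fun T : E => val (T (Sub laurent_one laurent_one_laurent)) 0)) /eqP.
by rewrite [_ == _](oner_eq0 L).
Qed.

HB.instance Definition _ := GRing.PzSemiRing_isNonZero.Build E laurent_endo_nonzero.

Variable sigma : {rmorphism L -> L}.

Lemma twisted_shift_is_zmod_morphism :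
  zmod_morphism (fun (u : int -> L) n => sigma (u (n - 1))).
Proof. by move=> u v; apply/funext => n; rewrite !fctE rmorphB. Qed.

Lemma twisted_shift_raises N (u : int -> L) :
  vanishes_below N u -> vanishes_below (N + 1) (fun n => sigma (u (n - 1))).
Proof. by move=> u0 n ltn; rewrite u0 ?rmorph0// ltrBlDr. Qed.

Lemma twisted_shift_vanishes N (u : int -> L) :
  vanishes_below N u -> vanishes_below N (fun n => sigma (u (n - 1))).
Proof. by move=> /twisted_shift_raises; apply: vanishes_belowW; rewrite lerDl. Qed.

(* [t * sum_n u_n t^n = sum_n sigma(u_n) t^(n+1)]. *)
Definition laurent_var : E :=
  laurent_operator twisted_shift_is_zmod_morphism twisted_shift_vanishes.

Lemma laurent_comm x : laurent_var * laurent_scal x = laurent_scal (sigma x) * laurent_var.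
Proof. by apply: endoP => f; apply: val_inj; apply/funext => n; exact: rmorphM. Qed.

Local Notation op := (skew_eval laurent_scal laurent_var : {poly L} -> E).

Lemma skew_eval_order a N f : vanishes_below N (val f) -> vanishes_below N (val (op a f)).
Proof.
elim/poly_ind: a f => [|a x IH] f f0; first by rewrite raddf0.
rewrite raddfD /= skew_evalMX skew_evalC; apply: vanishes_belowD; last exact: scale_vanishes.
by apply: (IH (laurent_var f)); exact: twisted_shift_vanishes.
Qed.

Lemma skew_evalMX_raises a : raises_order (op (a * 'X)).
Proof.
move=> N f f0; rewrite skew_evalMX; apply: (@skew_eval_order a _ (laurent_var f)).
exact: twisted_shift_raises.
Qed.

Hypothesis sigma_surj : forall y, exists x, sigma x = y.

Lemma laurent_var_inj : injective laurent_var.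
Proof.
apply: raddf_inj => f tf; apply: val_inj; apply/funext => n; apply: (fmorph_inj sigma).
have := congr1 (fun g : laurent_series => val g (n + 1)) tf.
by rewrite /= addrK => ->; rewrite rmorph0.
Qed.

Lemma laurent_var_surj g : exists f, laurent_var f = g.
Proof.
have /choice[tau tauK] := sigma_surj; pose u n := tau (val g (n + 1)).
have u_laurent : u \in laurent.
  have [N g0] := laurent_vanishes g; apply/asboolP; exists (N - 1) => n ltn.
  by apply: (fmorph_inj sigma); rewrite tauK rmorph0 g0// -ltrBrDr.
exists (Sub u u_laurent); apply: val_inj; apply/funext => n.
by rewrite -[LHS]/(sigma (tau (val g (n - 1 + 1)))) tauK subrK.
Qed.

Local Notation U := (classicalUnitRing E).

Lemma inj_surj_endo_unit (T : U) : injective (T : E) -> (forall g, exists f, (T : E) f = g) ->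
  T \is a GRing.unit.
Proof. by move=> T_inj /(inj_surj_endo_invertible T_inj) T_inv; exact/asboolP. Qed.

Lemma skew_eval_nonzero_const_unit a : a`_0 != 0 -> (op a : U) \is a GRing.unit.
Proof.
move=> a0; pose b : {poly L} := 1 - (a`_0)^-1 *: a.
have bE : b = drop_poly 1 b * 'X.
  apply/polyP => -[|i]; rewrite coefMX /= ?coef_drop_poly ?addn1//.
  by rewrite coefB coefZ coef1 mulVf// subrr.
have -> : op a = laurent_scal a`_0 * (1 - op b).
  by rewrite raddfB /= skew_eval1 subKr skew_evalZ mulrA -rmorphM divff ?rmorph1 ?mul1r.
have b_raises : raises_order (op b) by rewrite bE; exact: skew_evalMX_raises.
rewrite (@unitrMl U); last first.
  by apply: inj_surj_endo_unit; [exact: sub1_raising_inj|exact: sub1_raising_surj].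
by apply: (@rmorph_unit L U laurent_scal); rewrite unitfE.
Qed.

Lemma skew_eval_laurent_unit a : a != 0 -> (op a : U) \is a GRing.unit.
Proof.
move=> a0; have [m [b + aE]] := multiplicity_XsubC a 0.
rewrite a0 /root horner_coef0 => b0; rewrite aE subr0 skew_evalMXn.
rewrite (@unitrMl U) ?skew_eval_nonzero_const_unit//.
apply: (@unitrX U); apply: inj_surj_endo_unit; first exact: laurent_var_inj.
exact: laurent_var_surj.
Qed.

Definition laurent_inverting : skewInverting sigma :=
  @SkewInverting L sigma U laurent_scal laurent_var laurent_comm skew_eval_laurent_unit.

End LaurentSeries.

(** * The Frobenius automorphism *)

Section Frobenius.
Variables (p : nat) (L : fieldType).
Hypothesis charLp : p \in [pchar L].
Implicit Types (x : L) (n : nat).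

Definition frobenius : {rmorphism L -> L} := pFrobenius_aut charLp.

Lemma iter_frobenius n x : iter n frobenius x = x ^+ (p ^ n).
Proof.
elim: n => [|n IH]; first by rewrite expr1.
by rewrite iterS IH /= pFrobenius_autE -exprM -expnSr.
Qed.

End Frobenius.

Lemma closed_field_roots (L : closedFieldType) (a : {poly L}) : a != 0 ->
  exists s : seq L, forall x, root a x -> x \in s.
Proof.
move=> a0; have [s Es] := closed_field_poly_normal a; exists s => x.
by rewrite Es rootZ ?lead_coef_eq0// root_prod_XsubC.
Qed.

Section ClosedFieldFrobenius.
Variables (p : nat) (L : closedFieldType).
Hypothesis charLp : p \in [pchar L].

Lemma frobenius_infinite_order : infinite_order (frobenius charLp).
Proof.
move=> n n0; have p_gt1 := prime_gt1 (pcharf_prime charLp).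
have pn_gt1 : (1 < p ^ n)%N by rewrite -(exp1n n) ltn_exp2r.
have size_a : size ('X^(p ^ n) - ('X + 1%:P) : {poly L}) = (p ^ n).+1.
  by rewrite size_polyDl size_polyXn// size_polyN size_XaddC.
have /closed_rootP[x] : size ('X^(p ^ n) - ('X + 1%:P) : {poly L}) != 1%N.
  by rewrite size_a eqSS -lt0n ltnW.
rewrite /root !hornerE subr_eq0 => /eqP fx; exists x.
by rewrite iter_frobenius fx -subr_eq0 addrAC subrr add0r oner_eq0.
Qed.

Lemma frobenius_fixed_finite n : (0 < n)%N ->
  exists s : seq L, forall x, iter n (frobenius charLp) x = x -> x \in s.
Proof.
move=> n0; have [y fy] := frobenius_infinite_order n0.
have [|s root_s] := @closed_field_roots L ('X^(p ^ n) - 'X).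
  apply/eqP => /(congr1 (fun q : {poly L} => q.[y])); rewrite !hornerE => /eqP.
  by rewrite subr_eq0 -iter_frobenius (negPf fy).
exists s => x fx; apply: root_s.
by rewrite /root !hornerE -iter_frobenius fx subrr.
Qed.

End ClosedFieldFrobenius.

Section AlgebraicOverPrimeField.
Variables (p : nat) (L : fieldType) (f : {rmorphism 'F_p -> L}).
Hypotheses (charLp : p \in [pchar L]) (f_int : integralRange f).

Lemma frobenius_locally_periodic x :
  exists2 n, (0 < n)%N & iter n (frobenius charLp) x = x.
Proof.
have [q q_monic qx] := f_int x.
have [s powers_s] : exists s : seq L, forall i, iter i (frobenius charLp) x \in s.
  have [s poly_s] := @poly_coef_finite 'F_p (enum 'F_p) (size q).
  exists [seq (map_poly f r).[x] | r <- s] => i; apply/mapP; exists ('X^(p ^ i) %% q).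
    by apply: poly_s => [k|]; [rewrite mem_enum|rewrite ltnW// ltn_modp monic_neq0].
  rewrite iter_frobenius -(hornerXn x (p ^ i)) -(map_polyXn f) {1}(divp_eq 'X^(p ^ i) q).
  by rewrite rmorphD rmorphM /= hornerD hornerM (eqP qx) mulr0 add0r.
have [i [j [ltij E]]] := pigeonhole_nat powers_s.
exists (j - i)%N; first by rewrite subn_gt0.
apply: (fmorph_inj [the {rmorphism L -> L} of iter i (frobenius charLp)]).
by rewrite /= -iterD subnKC ?E// ltnW.
Qed.

End AlgebraicOverPrimeField.

Lemma infinite_order_locally_finite_exists p : prime p ->
  exists (L : closedFieldType) (sigma : locallyFiniteAut L), infinite_order sigma.
Proof.
move=> p_prime; have [L [f f_int]] := countable_algebraic_closure 'F_p.
have charLp : p \in [pchar L] by rewrite (fmorph_pchar f) pchar_Fp.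
exists L, (LocallyFiniteAut (frobenius_locally_periodic charLp f_int)
                            (frobenius_fixed_finite charLp)).
exact: frobenius_infinite_order.
Qed.

Theorem theorem4p1 :
  exists D : unitRingType,
    is_division_ring D /\ weakly_locally_finite D /\
    GKdimF D Rdefinitions.R = 1%E /\ ~ algebraic_over_center D.
Proof.
have [L [sigma sigma_inf]] := @infinite_order_locally_finite_exists 2 isT.
pose K := skew_frac_function_field (laurent_inverting (locally_finite_aut_surj sigma)).
exists K; split; first exact: skew_function_division.
split; first exact: skew_weakly_locally_finite.
split; last exact: skew_not_algebraic.
have centerK := center_divsubring (skew_function_division (K := K)).
apply: (@GKdimF_eq _ _ (spanF [:: 1; skew_var K]) 1).
- by eexists.
- by apply: (lincomb_mem centerK); exact: mem_head.
- exact: powV_dim_linear.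
- by move=> r s /(powV_dim_varX sigma_inf)/ltnW; rewrite expn1.
Qed.
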